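(* Let $(M,\tilde\varphi,\xi,\eta,\tilde g)$ be a $(2n+1)$-dimensional paracontact $(\tilde\kappa,\tilde\mu)$-manifold with $\tilde\kappa<-1$; assume the index of $\mathcal D_{\tilde\varphi\tilde h}(\pm\sqrt{-1-\tilde\kappa})$ is constant on $M$. Then the Ricci operator $\tilde Q$ of $\tilde g$ is given by $$\tilde Q=(2(1-n)+n\tilde\mu)I+(2(n-1)+\tilde\mu)\tilde h+(2(n-1)+n(2\tilde\kappa-\tilde\mu))\eta\otimes\xi.$$ In particular, $(M,\tilde g)$ is $\eta$-Einstein if and only if $\tilde\mu=2(1-n)$, and Einstein if and only if $\tilde\kappa=\frac{1-n^2}{n}$ and $\tilde\mu=2(1-n)$.
   Context: Conventions: $2d\eta(X,Y)=X(\eta(Y))-Y(\eta(X))-\eta([X,Y])$; $\tilde R_{XY}Z=\tilde\nabla_X\tilde\nabla_YZ-\tilde\nabla_Y\tilde\nabla_XZ-\tilde\nabla_{[X,Y]}Z$ with $\tilde\nabla$ the Levi-Civita connection of $\tilde g$. The Ricci operator is determined by $\tilde g(\tilde QX,W)=\sum_i\varepsilon_i\tilde g(\tilde R_{XE_i}E_i,W)$ for a local orthonormal frame $E_i$, $\varepsilon_i=\tilde g(E_i,E_i)=\pm1$. $\eta$-Einstein means $\tilde Q=aI+b\,\eta\otimes\xi$ for some $a,b\in\mathbb R$; Einstein means $\tilde Q=aI$ for some $a\in\mathbb R$. An almost paracontact structure on a $(2n+1)$-dimensional manifold $M$ is $(\tilde\varphi,\xi,\eta)$, with $\tilde\varphi$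 a $(1,1)$-tensor field, $\xi$ a vector field, $\eta$ a 1-form, such that $\eta(\xi)=1$, $\tilde\varphi^2=I-\eta\otimes\xi$ and the $\pm1$-eigendistributions of $\tilde\varphi$ on $\mathcal D=\ker\eta$ both have dimension $n$. With a pseudo-Riemannian metric $\tilde g$ satisfying $\tilde g(\tilde\varphi X,\tilde\varphi Y)=-\tilde g(X,Y)+\eta(X)\eta(Y)$ and $d\eta(X,Y)=\tilde g(X,\tilde\varphi Y)$ it is a paracontact metric structure. Put $\tilde h=\frac12\mathcal L_\xi\tilde\varphi$. A paracontact $(\tilde\kappa,\tilde\mu)$-manifold ($\tilde\kappa,\tilde\mu$ real constants) is a paracontact metric manifold whose curvature tensor satisfies $\tilde R_{XY}\xi=\tilde\kappa(\eta(Y)X-\eta(X)Y)+\tilde\mu(\eta(Y)\tilde hX-\eta(X)\tilde hY)$ for all vector fields $X,Y$. When $\tilde\kappa<-1$, $\tilde\varphi\tilde h$ is diagonalizable with eigenvalues $0$ and $\pm\sqrt{-1-\tilde\kappa}$ (the latter of multiplicity $n$ each); $\mathcal D_{\tilde\varphi\tilde h}(\pm\sqrt{-1-\tilde\kappa})$ are the corresponding eigendistributions, and the index is that of the restriction of $\tilde g$. *)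

(* Defs.v *)
From HB Require Import structures.
From mathcomp Require Import all_boot all_order all_algebra.
From mathcomp Require Import all_classical all_reals all_analysis.
From mathcomp Require Import ring.

Set Implicit Arguments.
Unset Strict Implicit.
Unset Printing Implicit Defensive.

Import Order.TTheory GRing.Theory Num.Theory numFieldNormedType.Exports.
Local Open Scope classical_set_scope.
Local Open Scope ring_scope.

Section SmoothFunctionsOfCoordinates.
Variables (R : realType) (m : nat).
Implicit Types (U : set 'rV[R]_m) (f g : 'rV[R]_m -> R).

(* Only used for an open set U, outside of which the values of f are junk. *)
Fixpoint Ck k U f : Prop :=
  {in U, continuous f} /\
  if k is l.+1 then
    forall i, (forall x, U x -> derivable f x (delta_mx 0 i)) /\
              Ck l U ('D_(delta_mx 0 i) f)
  else True.

Definition smooth_on U f := forall k, Ck k U f.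

Lemma Ck_continuous k U f : Ck k U f -> {in U, continuous f}.
Proof. by case: k => [|k] []. Qed.

Lemma Ck_eq k U f g : open U -> (forall x, U x -> f x = g x) ->
  Ck k U f -> Ck k U g.
Proof.
move=> oU.
have near_fg f' g' x : (forall x, U x -> f' x = g' x) -> U x ->
    \forall y \near x, f' y = g' y.
  by move=> fg Ux; apply: filterS fg _; exact: open_nbhs_nbhs.
have eqC f' g' : (forall x, U x -> f' x = g' x) ->
    {in U, continuous f'} -> {in U, continuous g'}.
  move=> fg cf x xU; have Ux : U x by rewrite inE in xU.
  rewrite /continuous_at -(fg x Ux); apply: cvg_trans (cf x xU).
  by apply: (@near_eq_cvg _ _ (nbhs x) _ f' g'); exact: near_fg.
elim: k f g => [|k IH] f g fg [cf df]; split=> //; try exact: eqC fg cf.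
move=> i; have [dfi Ci] := df i.
split=> [x Ux|]; first exact: near_eq_derivable (near_fg _ _ _ fg Ux) (dfi x Ux).
by apply: IH Ci => x Ux; exact: near_eq_derive (near_fg _ _ _ fg Ux).
Qed.

Lemma Ck_cst k U (c : R) : Ck k U (cst c).
Proof.
elim: k c => [|k IH] c; split=> //; try by move=> x _; exact: cst_continuous.
move=> i; split=> [x _|]; first exact: derivable_cst.
rewrite (_ : 'D_(delta_mx 0 i) (cst c) = cst 0); first exact: IH.
by apply/funext => x; rewrite derive_cst.
Qed.

Lemma Ck_le k U f : Ck k.+1 U f -> Ck k U f.
Proof.
elim: k f => [|k IH] f; first by case.
by case=> cf df; split=> // i; have [dfi /IH] := df i.
Qed.

Lemma Ck_add k U f g : open U -> Ck k U f -> Ck k U g -> Ck k U (f + g).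
Proof.
move=> oU; elim: k f g => [|k IH] f g Hf Hg.
  have [cf _] := Hf; have [cg _] := Hg.
  by split=> // x Ux; apply: continuousD; [exact: cf|exact: cg].
have [cf df] := Hf; have [cg dg] := Hg.
split=> [x Ux|i]; first by apply: continuousD; [exact: cf|exact: cg].
have [dfi Cf] := df i; have [dgi Cg] := dg i.
split=> [x Ux|]; first by apply: derivableD; [exact: dfi|exact: dgi].
apply: Ck_eq (IH _ _ Cf Cg) => // x Ux.
by rewrite deriveD//; [exact: dfi|exact: dgi].
Qed.

Lemma Ck_mul k U f g : open U -> Ck k U f -> Ck k U g -> Ck k U (f * g).
Proof.
move=> oU; elim: k f g => [|k IH] f g Hf Hg.
  have [cf _] := Hf; have [cg _] := Hg.
  by split=> // x Ux; apply: continuousM; [exact: cf|exact: cg].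
have [cf df] := Hf; have [cg dg] := Hg.
split=> [x Ux|i]; first by apply: continuousM; [exact: cf|exact: cg].
have [dfi Cf] := df i; have [dgi Cg] := dg i.
split=> [x Ux|]; first by apply: derivableM; [exact: dfi|exact: dgi].
have Cfg := Ck_add oU (IH _ _ (Ck_le Hf) Cg) (IH _ _ (Ck_le Hg) Cf).
apply: Ck_eq Cfg => // x Ux.
by rewrite deriveM//; [exact: dfi|exact: dgi].
Qed.

End SmoothFunctionsOfCoordinates.

Record chart (R : realType) (m : nat) (M : topologicalType) := Chart {
  chart_dom : set M;
  chart_map : M -> 'rV[R]_m;
  chart_inv : 'rV[R]_m -> M;
  chart_dom_open : open chart_dom;
  chart_cod_open : open (chart_map @` chart_dom);
  chart_mapK : {in chart_dom, cancel chart_map chart_inv};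
  chart_map_continuous : {in chart_dom, continuous chart_map};
  chart_inv_continuous : {in chart_map @` chart_dom, continuous chart_inv} }.

(* The atlas need not be maximal: it determines the maximal one. *)
Record smooth_manifold (R : realType) (m : nat) := SmoothManifold {
  carrier :> topologicalType;
  manifold_nonempty : [set: carrier] !=set0;
  manifold_hausdorff : hausdorff_space carrier;
  manifold_second_countable : @second_countable carrier;
  atlas : set (chart R m carrier);
  atlas_cover : forall p, exists2 c, atlas c & chart_dom c p;
  atlas_compatible : forall c c', atlas c -> atlas c' -> forall j,
    smooth_on (chart_map c @` (chart_dom c `&` chart_dom c'))
              (fun x => chart_map c' (chart_inv c x) 0 j) }.

Arguments atlas {R m} s.

Section SmoothFunctions.
Variables (R : realType) (m : nat) (M : smooth_manifold R m).

Definition smooth (f : M -> R) := forall c, atlas M c ->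
  smooth_on (chart_map c @` chart_dom c) (f \o chart_inv c).

Definition smooth_pred : {pred M -> R} := mem [set f | smooth f].
Definition smooth_pred_key : pred_key smooth_pred. Proof. exact. Qed.
Canonical smooth_pred_keyed := KeyedPred smooth_pred_key.

Lemma smooth_cst (c : R) : smooth (cst c).
Proof. by move=> ch _ k; exact: Ck_cst. Qed.

Lemma smooth_add f g : smooth f -> smooth g -> smooth (f + g).
Proof.
move=> sf sg c ac k.
exact: Ck_add (@chart_cod_open _ _ _ _) (sf _ ac k) (sg _ ac k).
Qed.

Lemma smooth_mul f g : smooth f -> smooth g -> smooth (f * g).
Proof.
move=> sf sg c ac k.
exact: Ck_mul (@chart_cod_open _ _ _ _) (sf _ ac k) (sg _ ac k).
Qed.

Lemma smooth_subring_closed : subring_closed smooth_pred.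
Proof.
split=> [|f g|f g]; rewrite !inE/=.
- exact: smooth_cst.
- move=> sf sg; rewrite -mulN1r; apply: smooth_add => //.
  by apply: smooth_mul => //; exact: (smooth_cst (-1)).
- exact: smooth_mul.
Qed.

HB.instance Definition _ :=
  GRing.isSubringClosed.Build _ smooth_pred smooth_subring_closed.

Record cinf := Cinf { cinf_fun :> M -> R; cinfP : cinf_fun \in smooth_pred }.

HB.instance Definition _ := [isSub for cinf_fun].
HB.instance Definition _ := [Choice of cinf by <:].
HB.instance Definition _ := GRing.SubChoice_isSubComPzRing.Build
  (M -> R) smooth_pred cinf smooth_subring_closed.

Lemma cinf_oner_neq0 : 1 != 0 :> cinf.
Proof.
apply/eqP => /(congr1 cinf_fun)/= e; have [p _] := manifold_nonempty M.
by have /eqP := congr1 (fun f => f p) e; apply/negP; exact: oner_neq0.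
Qed.

HB.instance Definition _ :=
  GRing.PzSemiRing_isNonZero.Build cinf cinf_oner_neq0.

Lemma cinf_cst_subproof (c : R) : cst c \in @smooth_pred.
Proof. by rewrite inE/=; exact: smooth_cst. Qed.
Definition cinf_cst (c : R) : cinf := Cinf (cinf_cst_subproof c).

End SmoothFunctions.

(* Vector fields are the derivations of the algebra of smooth functions, and
   tensor fields are the maps that are multilinear over that algebra. *)
Section VectorFields.
Variables (R : realType) (m : nat) (M : smooth_manifold R m).

Definition is_derivation (X : cinf M -> (cinf M)^o) :=
  (forall (c : R) f g, X (cinf_cst M c * f + g) = cinf_cst M c * X f + X g) /\
  (forall f g, X (f * g) = f * X g + g * X f).

Definition derivation_pred : {pred cinf M -> (cinf M)^o} :=
  mem [set X | is_derivation X].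
Definition derivation_pred_key : pred_key derivation_pred. Proof. exact. Qed.
Canonical derivation_pred_keyed := KeyedPred derivation_pred_key.

Lemma derivation_submod_closed : submod_closed derivation_pred.
Proof.
split=> [|a X Y]; rewrite !inE/=.
  by split=> *; rewrite -![GRing.zero _]/(0 : cinf M) !mulr0 addr0.
move=> [lX dX] [lY dY]; split=> [c f g|f g].
  rewrite -![(a *: X + Y) _]/(a * X _ + Y _).
  by rewrite lX lY; ring.
rewrite -![(a *: X + Y) _]/(a * X _ + Y _).
by rewrite dX dY; ring.
Qed.

HB.instance Definition _ := GRing.isSubmodClosed.Build (cinf M) _
  derivation_pred derivation_submod_closed.

Record vfield :=
  VField { vfield_fun :> cinf M -> (cinf M)^o; _ : vfield_fun \in derivation_pred }.

HB.instance Definition _ := [isSub for vfield_fun].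
HB.instance Definition _ := [Choice of vfield by <:].
HB.instance Definition _ := [SubChoice_isSubLmodule of vfield by <:].

Lemma vfieldP (X : vfield) : is_derivation X.
Proof. by have := valP X; rewrite inE. Qed.

Lemma vfieldD (X : vfield) f g : X (f + g) = X f + X g.
Proof.
have [lX _] := vfieldP X; have := lX 1 f g.
by rewrite (_ : cinf_cst M 1 = 1) ?mul1r//; exact: val_inj.
Qed.

Lemma lie_subproof (X Y : vfield) :
  (fun f => X (Y f) - Y (X f)) \in derivation_pred.
Proof.
have [lX dX] := vfieldP X; have [lY dY] := vfieldP Y.
rewrite inE/=; split=> [c f g|f g].
  by rewrite lY lX lX lY; ring.
by rewrite dX dY !vfieldD !dX !dY; ring.
Qed.

Definition lie X Y : vfield := VField (lie_subproof X Y).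

End VectorFields.

Section PseudoRiemannian.
Variables (R : realType) (m : nat) (M : smooth_manifold R m).
Notation V := (vfield M).
Implicit Types (X Y Z W : V) (p : M) (g : V -> V -> cinf M).

(* Tangent vectors at p are point derivations of the algebra of smooth
   functions; each of them is the value at p of some vector field. *)
Definition value_at p X : cinf M -> R^o := fun f => X f p.

(* For tensor fields T of type (1,1) and theta of type (0,1): the subspaces
   of T_pM formed by the eigenvectors of T_p for c and by the kernel of
   theta_p. *)
Definition eigenspace_at (T : V -> V) (c : R) p : set (cinf M -> R^o) :=
  [set v | exists X, value_at p X = v /\ value_at p (T X) = c *: v].

Definition kernel_at (theta : V -> cinf M) p : set (cinf M -> R^o) :=
  [set v | exists X, value_at p X = v /\ theta X p = 0].

Definition has_dim (E : lmodType R) (S : set E) (k : nat) :=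
  exists b : 'I_k -> E,
    (forall c : 'I_k -> R, \sum_i c i *: b i = 0 -> forall i, c i = 0) /\
    S = [set v | exists c : 'I_k -> R, v = \sum_i c i *: b i].

Record pseudo_riemannian_metric g : Prop := {
  metric_sym : forall X Y, g X Y = g Y X;
  metric_linear : forall f X Y Z, g (f *: X + Y) Z = f * g X Z + g Y Z;
  metric_nondegenerate :
    forall p X, (forall Y, g X Y p = 0) -> value_at p X = 0 }.

Definition negative_definite_at g p (W : set (cinf M -> R^o)) :=
  forall X, W (value_at p X) -> value_at p X != 0 -> g X X p < 0.

(* k is the index of the restriction of g_p to the subspace S of T_pM: the
   largest dimension of a subspace of S on which g_p is negative definite. *)
Definition index_at g p (S : set (cinf M -> R^o)) (k : nat) :=
  (exists W : set (cinf M -> R^o),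
    [/\ W `<=` S, has_dim W k & negative_definite_at g p W]) /\
  (forall (W : set (cinf M -> R^o)) l, W `<=` S -> has_dim W l -> negative_definite_at g p W ->
    (l <= k)%N).

Record levi_civita g (nabla : V -> V -> V) : Prop := {
  connection_linear : forall f X Y Z,
    nabla (f *: X + Y) Z = f *: nabla X Z + nabla Y Z;
  connection_additive : forall X Y Z,
    nabla X (Y + Z) = nabla X Y + nabla X Z;
  connection_leibniz : forall f X Y,
    nabla X (f *: Y) = X f *: Y + f *: nabla X Y;
  connection_torsion_free : forall X Y, nabla X Y - nabla Y X = lie X Y;
  connection_metric : forall X Y Z,
    Z (g X Y) = g (nabla Z X) Y + g X (nabla Z Y) }.

Definition curvature (nabla : V -> V -> V) X Y Z : V :=
  nabla X (nabla Y Z) - nabla Y (nabla X Z) - nabla (lie X Y) Z.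

Definition orthonormal_frame_on g (U : set M) (E : 'I_m -> V) :=
  forall q, U q ->
    (forall i, g (E i) (E i) q = 1 \/ g (E i) (E i) q = -1) /\
    (forall i j, i != j -> g (E i) (E j) q = 0).

(* A local orthonormal frame around p extends, after shrinking its domain U,
   to global vector fields; the sum does not depend on the frame. *)
Definition ricci_operator g (nabla : V -> V -> V) (Q : V -> V) :=
  forall p, exists (U : set M) (E : 'I_m -> V),
    [/\ open_nbhs p U, orthonormal_frame_on g U E &
      forall X W q, U q ->
        g (Q X) W q =
        \sum_i g (E i) (E i) q * g (curvature nabla X (E i) (E i)) W q].

Definition einstein (Q : V -> V) :=
  exists a : R, forall X, Q X = cinf_cst M a *: X.

Definition eta_einstein xi (eta : V -> cinf M) (Q : V -> V) :=
  exists a b : R, forall X,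
    Q X = cinf_cst M a *: X + (cinf_cst M b * eta X) *: xi.

(* The convention carries a factor 1/2: 2 d eta (X, Y) = X (eta Y) - ... *)
Definition exterior_derivative (eta : V -> cinf M) X Y : cinf M :=
  cinf_cst M 2^-1 * (X (eta Y) - Y (eta X) - eta (lie X Y)).

Definition lie_derivative xi (phi : V -> V) X : V :=
  lie xi (phi X) - phi (lie xi X).

End PseudoRiemannian.

Section Paracontact.
Variables (R : realType) (n : nat) (M : smooth_manifold R n.*2.+1).
Notation V := (vfield M).
Implicit Types (X Y : V) (g : V -> V -> cinf M).
Variables (phi : {linear V -> V}) (xi : V) (eta : {linear V -> (cinf M)^o}).

Record almost_paracontact : Prop := {
  paracontact_eta_xi : eta xi = 1;
  paracontact_phi_phi : forall X, phi (phi X) = X - eta X *: xi;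
  paracontact_eigen_dim : forall p,
    has_dim (kernel_at eta p `&` eigenspace_at phi 1 p) n /\
    has_dim (kernel_at eta p `&` eigenspace_at phi (-1) p) n }.

Record paracontact_metric g : Prop := {
  paracontact_almost : almost_paracontact;
  paracontact_pseudo_riemannian : pseudo_riemannian_metric g;
  paracontact_compatible : forall X Y,
    g (phi X) (phi Y) = - g X Y + eta X * eta Y;
  paracontact_contact : forall X Y,
    exterior_derivative eta X Y = g X (phi Y) }.

Definition h_tensor X : V := cinf_cst M 2^-1 *: lie_derivative xi phi X.

Definition kappa_mu_condition (nabla : V -> V -> V) (kappa mu : R) :=
  forall X Y, curvature nabla X Y xi =
    cinf_cst M kappa *: (eta Y *: X - eta X *: Y) +
    cinf_cst M mu *: (eta Y *: h_tensor X - eta X *: h_tensor Y).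

End Paracontact.

(* Main.v *)
From HB Require Import structures.
Require Import Defs.
From mathcomp Require Import all_boot all_order all_algebra.
From mathcomp Require Import all_classical all_reals all_analysis.
From mathcomp Require Import ring lra.

Set Implicit Arguments.
Unset Strict Implicit.
Unset Printing Implicit Defensive.

Import Order.TTheory GRing.Theory Num.Theory numFieldNormedType.Exports.
Local Open Scope classical_set_scope.
Local Open Scope ring_scope.

(** The proof computes the whole curvature tensor R and contracts it.

Let S be the symmetric part of the endomorphism nabla xi; its skew part is
-phi because d eta (X, Y) = g (X, phi Y). Closedness of d eta, which here comes
out of the first Bianchi identity, and differentiation of
phi^2 = I - eta (x) xi along xi show that S anticommutes with phi, that
nabla_xi phi = 0 and that h = phi S.

The nullity condition for Y = xi splits into a part that commutes with phi and
a part that anticommutes with it: S^2 = (-1 - kappa) phi^2 and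
nabla_xi S = - mu h. As kappa < -1, S is invertible on ker eta, with the two
constant eigenvalues +-sqrt (-1 - kappa) exchanged by phi. For X and Y in ker eta
R (X, Y) xi vanishes, which is a Codazzi equation for S - phi. Together with
the symmetries of nabla phi and nabla S and the invertibility of S it forces
the horizontal components of nabla phi, and then those of nabla S, to vanish
(cov_der_phi_hor, cov_der_shape_hor). Hence nabla phi and nabla S are explicit,
and the Ricci identity gives the commutators of R (X, Y) with phi and with S
(curvature_phi, curvature_shape).

These commutators leave no freedom: an algebraic curvature tensor that commutes
with phi and S on ker eta and kills xi is zero (curvature_like_eq0). So R
equals any algebraic curvature tensor with the same commutators and the same
value on xi, and curvature_model is one (curvature_eq_model). Its contraction
is the asserted formula, since phi, S and h are trace-free; the equivalences
follow because h is not a combination of I and eta (x) xi.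

The contraction needs that the values of an orthonormal frame span each tangent
space and that the value of a tensor field at a point depends only on the values
of its arguments there. Vector fields being derivations, the second property is
not formal. It holds at a point q if the rank r of the tangent spaces is
maximal at q among the points where some function F is nonzero: if
d = det (X_i f_j) is nonzero at q, then for each vector field Y a bordered
determinant gives a combination Z of Y and the X_i, with coefficient d at Y,
that is zero where F is nonzero; hence F Z = 0 (generic_vanishing). Applied to
F = g (Q X - Z', W), where Z' is the asserted value of Q X, it reduces the
formula to such points, where paracontact_eigen_dim bounds the rank by the
number of frame vectors. *)

(** * Tensors at a generic point *)

Section Evaluation.
Variables (R : realType) (m : nat) (M : smooth_manifold R m).
Notation V := (vfield M).

Definition eval_at (p : M) (f : cinf M) : R := f p.

Lemma eval_at_zmod p : zmod_morphism (eval_at p). Proof. by []. Qed.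
Lemma eval_at_monoid p : monoid_morphism (eval_at p). Proof. by []. Qed.
HB.instance Definition _ p :=
  GRing.isZmodMorphism.Build (cinf M) R (eval_at p) (eval_at_zmod p).
HB.instance Definition _ p :=
  GRing.isMonoidMorphism.Build (cinf M) R (eval_at p) (eval_at_monoid p).

Lemma eval_sum p r (c u : 'I_r -> cinf M) :
  (\sum_i c i * u i) p = \sum_i c i p * u i p.
Proof. exact: (rmorph_sum (eval_at p)). Qed.

Lemma cinf_eq (f g : cinf M) : (forall p, f p = g p) -> f = g.
Proof. by move=> fg; apply/val_inj/funext. Qed.

Lemma vfield_eq (X Y : V) : (forall f, X f = Y f) -> X = Y.
Proof. by move=> XY; apply/val_inj/funext. Qed.

Definition cinf_linear (T : V -> cinf M) :=
  forall f X Y, T (f *: X + Y) = f * T X + T Y.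

Section Linear.
Variables (T : V -> cinf M).
Hypothesis linT : cinf_linear T.

Lemma cinf_linear0 : T 0 = 0.
Proof. by have := linT (-1) 0 0; rewrite scaler0 addr0 mulN1r addNr. Qed.

Lemma cinf_linearZ f X : T (f *: X) = f * T X.
Proof. by rewrite -[f *: X]addr0 linT cinf_linear0 addr0. Qed.

Lemma cinf_linearD X Y : T (X + Y) = T X + T Y.
Proof. by rewrite -[X]scale1r linT mul1r scale1r. Qed.

Lemma cinf_linear_sum r (c : 'I_r -> cinf M) (X : 'I_r -> V) :
  T (\sum_i c i *: X i) = \sum_i c i * T (X i).
Proof.
elim: r c X => [|r IH] c X; first by rewrite !big_ord0 cinf_linear0.
by rewrite !big_ord_recl linT IH.
Qed.

End Linear.

Lemma eval_sum_field r (c : 'I_r -> cinf M) (X : 'I_r -> V) f :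
  (\sum_i c i *: X i) f = \sum_i c i * X i f.
Proof. exact: (@cinf_linear_sum (fun X => X f)). Qed.

End Evaluation.

Section GenericRank.
Variables (R : realType) (m : nat) (M : smooth_manifold R m).
Notation V := (vfield M).

Definition pairing r (X : 'I_r -> V) (f : 'I_r -> cinf M) : 'M[cinf M]_r :=
  \matrix_(i, j) X i (f j).

Definition adjoin {T : Type} r (x : T) (s : 'I_r -> T) (i : 'I_r.+1) : T :=
  oapp s x (unlift ord0 i).

(** The cofactors of the first column do not involve that column, so this
    combination of Y and the X i acts on k as the bordered determinant whose
    first column is their action on k. The 0 is a placeholder for k. *)
Definition minor_field r (Y : V) (X : 'I_r -> V) (f : 'I_r -> cinf M) : V :=
  \sum_i cofactor (pairing (adjoin Y X) (adjoin 0 f)) i ord0 *: adjoin Y X i.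

Lemma minor_fieldE r Y X (f : 'I_r -> cinf M) k :
  minor_field Y X f k = \det (pairing (adjoin Y X) (adjoin k f)).
Proof.
rewrite (expand_det_col _ ord0) /minor_field eval_sum_field.
apply: eq_bigr => i _; rewrite mulrC; congr (_ * _).
  by rewrite mxE /adjoin unlift_none.
rewrite /cofactor; congr (_ * \det _); apply/matrixP => a b.
by rewrite !mxE /adjoin liftK.
Qed.

Lemma cofactor_pairing0 r Y X (f : 'I_r -> cinf M) k :
  cofactor (pairing (adjoin Y X) (adjoin k f)) ord0 ord0 = \det (pairing X f).
Proof.
rewrite /cofactor expr0 mul1r; congr (\det _); apply/matrixP => a b.
by rewrite !mxE /adjoin !liftK.
Qed.

Lemma cofactor_pairing_lift r Y X (f : 'I_r -> cinf M) k q i :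
  value_at q Y = 0 ->
  cofactor (pairing (adjoin Y X) (adjoin k f)) (lift ord0 i) ord0 q = 0.
Proof.
move=> Y0; rewrite -[LHS]/(eval_at q _) /cofactor rmorphM /= -det_map_mx.
have /unlift_some[j ji _] : lift ord0 i != ord0 by rewrite eq_sym neq_lift.
rewrite (expand_det_row _ j) big1 ?mulr0// => b _.
rewrite !mxE -ji /adjoin unlift_none liftK /=.
by rewrite -[eval_at q _]/(value_at q Y (f b)) Y0 mul0r.
Qed.

Lemma det_pairing_eval r (X : 'I_r -> V) (f : 'I_r -> cinf M) q :
  \det (pairing X f) q = \det (\matrix_(i, j) X i (f j) q).
Proof.
rewrite -[LHS]/(eval_at q _) -det_map_mx; congr (\det _).
by apply/matrixP => i j; rewrite !mxE.
Qed.

(** An upper bound k for the dimension of the space of values at q. *)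
Definition tangent_spanned k (q : M) :=
  exists b : 'I_k -> cinf M -> R^o,
    forall X : V, exists c : 'I_k -> R, value_at q X = \sum_i c i *: b i.

(** The matrix factors through a space of dimension k. *)
Lemma det_pairing_spanned k q r (X : 'I_r -> V) f :
  tangent_spanned k q -> (k < r)%N -> \det (pairing X f) q = 0.
Proof.
move=> [b bP] kr; rewrite det_pairing_eval; apply/eqP.
rewrite -[_ == 0]negbK -unitfE -unitmxE -row_full_unit; apply/negP => /eqP rk.
have /choice[c cP] : forall i, exists c : 'I_k -> R,
  value_at q (X i) = \sum_l c l *: b l by move=> i; exact: bP.
have : (\rank (\matrix_(i, l) c i l *m \matrix_(l, j) b l (f j) :
          'M[R]_(r, r)) <= k)%N by exact: mulmx_max_rank.
rewrite (_ : _ *m _ = \matrix_(i, j) X i (f j) q); first by rewrite rk leqNgt kr.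
apply/matrixP => i j; rewrite !mxE -[RHS]/(value_at q (X i) (f j)) cP.
by rewrite fct_sumE; apply: eq_bigr => l _; rewrite !mxE.
Qed.

Definition pointwise_at (q : M) :=
  forall T X, cinf_linear T -> value_at q X = 0 -> T X q = 0.

(** If F is nonzero somewhere, choose q with F q <> 0 where the rank r of the
    pairing of vector fields with functions is the largest that occurs where F
    is nonzero. The minor field of any Y is then killed by F, and at q it is a
    nonzero multiple of Y up to fields whose coefficients vanish with Y. So
    tensors are pointwise at q, which contradicts F q <> 0. *)
Lemma generic_vanishing k (F : cinf M) : (forall q, tangent_spanned k q) ->
  (forall q, pointwise_at q -> F q = 0) -> F = 0.
Proof.
move=> span Fgen; apply: contrapT => F0.
pose P r := `[< exists q X f, F q != 0 /\ \det (@pairing r X f) q != 0 >].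
have exP : exists r, P r.
  have [q Fq] : exists q, F q != 0.
    apply: contrapT => nF; apply: F0; apply: cinf_eq => q; apply/eqP.
    by apply: contrapT => /negP Fq; apply: nF; exists q.
  exists 0; apply/asboolP; exists q, (fun=> 0), (fun=> 0); split=> //.
  by rewrite det_mx00 oner_neq0.
have boundP r : P r -> (r <= k)%N.
  move=> /asboolP[q [X [f [_ d0]]]]; rewrite leqNgt; apply/negP => kr.
  by rewrite (det_pairing_spanned _ _ (span q) kr) eqxx in d0.
have [r /asboolP[q [X [f [Fq dq]]]] rmax] := ex_maxnP exP boundP.
suff : F q = 0 by move/eqP; rewrite (negPf Fq).
apply: Fgen => T Y linT Y0.
have FZ0 : F *: minor_field Y X f = 0.
  apply: vfield_eq => k'; apply: cinf_eq => q'.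
  rewrite -[LHS]/(F q' * minor_field Y X f k' q') minor_fieldE.
  have [->|Fq'] := eqVneq (F q') 0; first by rewrite mul0r.
  suff -> : \det (pairing (adjoin Y X) (adjoin k' f)) q' = 0 by rewrite mulr0.
  apply/eqP; apply: contrapT => /negP dq'.
  have : P r.+1 by apply/asboolP; exists q', (adjoin Y X), (adjoin k' f).
  by move/rmax; rewrite ltnn.
have : F q * T (minor_field Y X f) q = 0.
  rewrite -[LHS]/((F * T (minor_field Y X f)) q) -cinf_linearZ// FZ0.
  by rewrite cinf_linear0.
rewrite cinf_linear_sum// eval_sum big_ord_recl big1 ?addr0 => [|i _]; last first.
  by rewrite cofactor_pairing_lift// mul0r.
rewrite cofactor_pairing0 /adjoin unlift_none /= => /eqP.
by rewrite !mulf_eq0 (negPf Fq) (negPf dq) => /eqP.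
Qed.

End GenericRank.

Section Frames.
Variables (R : realType) (m : nat) (M : smooth_manifold R m).
Notation V := (vfield M).
Notation cst := (cinf_cst M).

Lemma value_at_sum q r (c : 'I_r -> R) (X : 'I_r -> V) :
  value_at q (\sum_i cst (c i) *: X i) = \sum_i c i *: value_at q (X i).
Proof.
apply/funext => f; rewrite -[LHS]/((\sum_i cst (c i) *: X i) f q).
by rewrite eval_sum_field eval_sum fct_sumE; apply: eq_bigr.
Qed.

(** An orthonormal family of m fields has independent values where tensors are
    pointwise, since g then detects relations among values. There are as many of
    them as spanning vectors, hence they form a basis. *)
Lemma frame_expansion g (E : 'I_m -> V) q T X :
  pseudo_riemannian_metric g -> tangent_spanned m q -> pointwise_at q ->
  (forall i, g (E i) (E i) q = 1 \/ g (E i) (E i) q = -1) ->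
  (forall i j, i != j -> g (E i) (E j) q = 0) -> cinf_linear T ->
  T X q = \sum_i g (E i) (E i) q * g X (E i) q * T (E i) q.
Proof.
move=> [gsym glin _] [b bP] ptw Enorm Eorth linT.
have glinl Y : cinf_linear (g^~ Y) by move=> f X1 X2; exact: glin.
have gE c l : g (\sum_i cst (c i) *: E i) (E l) q = c l * g (E l) (E l) q.
  rewrite (cinf_linear_sum (glinl _)) eval_sum (bigD1 l)//= big1 ?addr0// => i il.
  by rewrite Eorth// mulr0.
have Esq l : g (E l) (E l) q * g (E l) (E l) q = 1.
  by have [] := Enorm l => ->; ring.
have /choice[C CP] : forall i, exists c : 'I_m -> R,
  value_at q (E i) = \sum_l c l *: b l by move=> i; exact: bP.
pose K := \matrix_(i, j) C i j.
have sumE (v : 'rV[R]_m) :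
    value_at q (\sum_i cst (v 0 i) *: E i) = \sum_j (v *m K) 0 j *: b j.
  rewrite value_at_sum; under eq_bigr => i _ do rewrite CP scaler_sumr.
  rewrite exchange_big; apply: eq_bigr => j _; rewrite mxE scaler_suml.
  by apply: eq_bigr => i _; rewrite mxE scalerA.
have Kunit : K \in unitmx.
  rewrite -row_free_unit; apply: inj_row_free => v vK0.
  have v0 : value_at q (\sum_i cst (v 0 i) *: E i) = 0.
    by rewrite sumE vK0 big1// => j _; rewrite mxE scale0r.
  apply/rowP => l; rewrite mxE -[v 0 l]mulr1 -(Esq l) mulrA -(gE (v 0)).
  by rewrite (ptw (g^~ (E l)))// mul0r.
have [x xP] := bP X.
pose v : 'rV[R]_m := (\row_j x j) *m invmx K.
have X0 : value_at q (X - \sum_i cst (v 0 i) *: E i) = 0.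
  have -> : value_at q (X - \sum_i cst (v 0 i) *: E i) =
      value_at q X - value_at q (\sum_i cst (v 0 i) *: E i) by [].
  apply/eqP; rewrite sumE mulmxKV// xP subr_eq0; apply/eqP.
  by apply: eq_bigr => j _; rewrite mxE.
have TX T' : cinf_linear T' -> T' X q = \sum_i v 0 i * T' (E i) q.
  move=> linT'; rewrite -[X](subrK (\sum_i cst (v 0 i) *: E i)).
  rewrite cinf_linearD// -[LHS]/(T' _ q + T' _ q) (ptw T' _ linT' X0) add0r.
  by rewrite cinf_linear_sum// eval_sum.
rewrite TX//; apply: eq_bigr => i _; congr (_ * _).
rewrite (TX _ (glinl _)) (bigD1 i)//= big1 ?addr0 => [|j ji].
  by rewrite mulrCA Esq mulr1.
by rewrite Eorth// mulr0.
Qed.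

End Frames.

(** * The curvature tensor of a pseudo-Riemannian metric *)

Section Evaluated.
Variables (R : realType) (m : nat) (M : smooth_manifold R m).
Notation V := (vfield M).
Notation cst := (cinf_cst M).
Implicit Types (X Y Z W : V) (f h : cinf M) (p : M).

Lemma vfield_eq_at X Y : (forall f p, X f p = Y f p) -> X = Y.
Proof. by move=> XY; apply: vfield_eq => f; apply: cinf_eq => p. Qed.

Lemma evalD f h p : (f + h) p = f p + h p. Proof. by []. Qed.
Lemma evalN f p : (- f) p = - f p. Proof. by []. Qed.
Lemma evalM f h p : (f * h) p = f p * h p. Proof. by []. Qed.
Lemma eval0 p : (0 : cinf M) p = 0. Proof. by []. Qed.
Lemma eval1 p : (1 : cinf M) p = 1. Proof. by []. Qed.
Lemma eval_cst c p : cst c p = c. Proof. by []. Qed.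
Definition evalE := (evalD, evalN, evalM, eval0, eval1, eval_cst).

Lemma fieldD X Y f : (X + Y) f = X f + Y f. Proof. by []. Qed.
Lemma fieldN X f : (- X) f = - X f. Proof. by []. Qed.
Lemma fieldZ h X f : (h *: X) f = h * X f. Proof. by []. Qed.
Lemma field0 f : (0 : V) f = 0. Proof. by []. Qed.
Definition fieldE := (fieldD, fieldN, fieldZ, field0).

Lemma field_fun0 X : X 0 = 0.
Proof.
have /eqP := vfieldD X 0 0; rewrite addr0 -subr_eq0 opprD addrA subrr add0r.
by rewrite oppr_eq0 => /eqP.
Qed.

Lemma field_funN X f : X (- f) = - X f.
Proof. by apply/eqP; rewrite -addr_eq0 -vfieldD addNr field_fun0. Qed.

Lemma field_funM X f h : X (f * h) = f * X h + h * X f.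
Proof. by have [_] := vfieldP X. Qed.

Lemma field_fun1 X : X 1 = 0.
Proof.
have := field_funM X 1 1; rewrite !mul1r => /eqP.
by rewrite -subr_eq0 opprD addrA subrr add0r oppr_eq0 => /eqP.
Qed.

Lemma field_fun_cst X c : X (cst c) = 0.
Proof.
have [linX _] := vfieldP X; have := linX c 1 0.
by rewrite addr0 mulr1 field_fun1 field_fun0 mulr0 addr0.
Qed.

Lemma lieE X Y f : lie X Y f = X (Y f) - Y (X f). Proof. by []. Qed.

End Evaluated.

(** Evaluation by syntactic matching, for large expressions on which unifying
    evalE with every atom is slow. *)
Ltac push_eval :=
  repeat match goal with
  | |- context [cinf_fun (@Algebra.add ?V ?f ?h) ?p] =>
    change (cinf_fun (@Algebra.add V f h) p) with (cinf_fun f p + cinf_fun h p)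
  | |- context [cinf_fun (@Algebra.opp ?V ?f) ?p] =>
    change (cinf_fun (@Algebra.opp V f) p) with (- cinf_fun f p)
  | |- context [cinf_fun (@GRing.mul ?V ?f ?h) ?p] =>
    change (cinf_fun (@GRing.mul V f h) p) with (cinf_fun f p * cinf_fun h p)
  | |- context [cinf_fun (@Algebra.natmul ?V ?f ?n) ?p] =>
    change (cinf_fun (@Algebra.natmul V f n) p) with (cinf_fun f p *+ n)
  | |- context [@cinf_fun ?R _ _ (@Algebra.zero ?V) ?p] =>
    change (cinf_fun (@Algebra.zero V) p) with (0 : R)
  | |- context [@cinf_fun ?R _ _ (@GRing.one ?V) ?p] =>
    change (cinf_fun (@GRing.one V) p) with (1 : R)
  | |- context [cinf_fun (cinf_cst ?M ?c) ?p] =>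
    change (cinf_fun (cinf_cst M c) p) with c
  end.

(** Values of functions become variables, since comparing them as atoms up to
    conversion is slow. *)
Ltac generalize_evals :=
  cbv delta [reverse_coercion]; push_eval;
  repeat match goal with |- context [cinf_fun ?f ?p] =>
    generalize (cinf_fun f p); intro end.
Ltac eval_ring := rewrite ?evalE; first [by generalize_evals; ring | ring].
Ltac eval_field := generalize_evals; field.
Ltac eval_lra := rewrite ?evalE; first [by generalize_evals; lra | lra].
Ltac field_lra := apply: vfield_eq_at => ? ?; rewrite ?fieldE; eval_lra.
Ltac field_ring := apply: vfield_eq_at => ? ?; rewrite ?fieldE; eval_ring.

Section LeviCivita.
Variables (R : realType) (m : nat) (M : smooth_manifold R m).
Notation V := (vfield M).
Notation cst := (cinf_cst M).
Variables (g : V -> V -> cinf M) (nabla : V -> V -> V).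
Hypotheses (gP : pseudo_riemannian_metric g) (nablaP : levi_civita g nabla).
Implicit Types (X Y Z W : V) (f : cinf M) (p : M).

Lemma gC X Y : g X Y = g Y X. Proof. by have [] := gP. Qed.

Lemma g_linear Y : cinf_linear (g^~ Y).
Proof. by have [_ glin _] := gP => f X1 X2; exact: glin. Qed.

Lemma gDl X Y Z : g (X + Y) Z = g X Z + g Y Z.
Proof. exact: (cinf_linearD (g_linear Z)). Qed.
Lemma gDr X Y Z : g X (Y + Z) = g X Y + g X Z.
Proof. by rewrite gC gDl !(gC _ X). Qed.
Lemma gZl f X Y : g (f *: X) Y = f * g X Y.
Proof. exact: (cinf_linearZ (g_linear Y)). Qed.
Lemma gZr f X Y : g X (f *: Y) = f * g X Y.
Proof. by rewrite gC gZl gC. Qed.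
Lemma gNl X Y : g (- X) Y = - g X Y.
Proof. by rewrite -scaleN1r gZl mulN1r. Qed.
Lemma gNr X Y : g X (- Y) = - g X Y.
Proof. by rewrite gC gNl gC. Qed.
Lemma g0l X : g 0 X = 0. Proof. exact: (cinf_linear0 (g_linear X)). Qed.
Lemma g0r X : g X 0 = 0. Proof. by rewrite gC g0l. Qed.
Definition gE := (gDl, gDr, gNl, gNr, gZl, gZr, g0l, g0r).

Lemma g_eq X Y : (forall p W, g X W p = g Y W p) -> X = Y.
Proof.
move=> XY; apply: vfield_eq_at => f p; have [_ _ nondeg] := gP.
have /(congr1 (fun v => v f)) e : value_at p (X - Y) = 0.
  by apply: nondeg => W; rewrite gDl gNl !evalE XY subrr.
by apply/eqP; rewrite -subr_eq0; apply/eqP; exact: e.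
Qed.

Lemma nablaDl X Y Z : nabla (X + Y) Z = nabla X Z + nabla Y Z.
Proof.
have [lin _ _ _ _] := nablaP.
by rewrite -[X in nabla (X + _)]scale1r lin scale1r.
Qed.
Lemma nabla0l Z : nabla 0 Z = 0.
Proof. by apply: (addrI (nabla 0 Z)); rewrite -nablaDl !addr0. Qed.
Lemma nablaZl f X Z : nabla (f *: X) Z = f *: nabla X Z.
Proof.
have [lin _ _ _ _] := nablaP.
by rewrite -[f *: X]addr0 lin nabla0l addr0.
Qed.
Lemma nablaNl X Z : nabla (- X) Z = - nabla X Z.
Proof. by rewrite -scaleN1r nablaZl scaleN1r. Qed.
Lemma nablaDr X Y Z : nabla X (Y + Z) = nabla X Y + nabla X Z.
Proof. by have [_ + _ _ _] := nablaP. Qed.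
Lemma nablaZr X f Y : nabla X (f *: Y) = X f *: Y + f *: nabla X Y.
Proof. by have [_ _ + _ _] := nablaP. Qed.
Lemma nabla0r X : nabla X 0 = 0.
Proof. by apply: (addrI (nabla X 0)); rewrite -nablaDr !addr0. Qed.
Lemma nablaNr X Y : nabla X (- Y) = - nabla X Y.
Proof. by apply/eqP; rewrite -addr_eq0 -nablaDr addNr nabla0r. Qed.
Lemma nabla_cstr X c Y : nabla X (cst c *: Y) = cst c *: nabla X Y.
Proof. by rewrite nablaZr field_fun_cst scale0r add0r. Qed.
Definition nablaE :=
  (nablaDl, nablaDr, nablaNl, nablaNr, nabla_cstr, nablaZl, nablaZr, nabla0l,
   nabla0r).

Lemma lie_nabla X Y : lie X Y = nabla X Y - nabla Y X.
Proof. by have [_ _ _ + _] := nablaP. Qed.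
Lemma field_g X Y Z : Z (g X Y) = g (nabla Z X) Y + g X (nabla Z Y).
Proof. by have [_ _ _ _] := nablaP. Qed.

Local Notation Rm := (curvature nabla).

Lemma curvature_linear Y Z W : cinf_linear (fun X => g (Rm X Y Z) W).
Proof.
move=> f X1 X2 /=.
have -> : Rm (f *: X1 + X2) Y Z = f *: Rm X1 Y Z + Rm X2 Y Z.
  have lieZ : lie (f *: X1 + X2) Y = f *: lie X1 Y + lie X2 Y - Y f *: X1.
    rewrite !lie_nabla !nablaE; field_ring.
  rewrite /curvature lieZ !nablaE; field_ring.
by rewrite !gE.
Qed.

Lemma curvature_skew12 X Y Z : Rm X Y Z = - Rm Y X Z.
Proof.
have lieC : lie X Y = - lie Y X by rewrite !lie_nabla; field_ring.
rewrite /curvature lieC nablaNl; field_ring.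
Qed.

Lemma jacobi X Y Z :
  lie X (lie Y Z) + lie Y (lie Z X) + lie Z (lie X Y) = 0.
Proof.
apply: vfield_eq_at => f p.
rewrite !fieldE !lieE !vfieldD !field_funN; eval_ring.
Qed.

Lemma bianchi X Y Z : Rm X Y Z + Rm Y Z X + Rm Z X Y = 0.
Proof.
have := jacobi X Y Z; rewrite 3!(lie_nabla _ (lie _ _)) => J.
have e (U W W' : V) : nabla U (lie W W') =
    nabla U (nabla W W') - nabla U (nabla W' W) by rewrite lie_nabla !nablaE.
rewrite -J /curvature !e; field_ring.
Qed.

Lemma curvature_skew34 X Y Z W : g (Rm X Y Z) W = - g (Rm X Y W) Z.
Proof.
apply: cinf_eq => p.
have e1 := field_g Z W (lie X Y); rewrite lieE in e1.
have := congr1 (fun f : cinf M => f p) e1.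
rewrite !field_g !vfieldD !field_g /curvature !gE !evalE.
rewrite !(gC _ Z) !(gC _ W) !(gC _ (nabla _ Z)) ; lra.
Qed.

End LeviCivita.

(** * Algebraic curvature tensors *)

Section CurvatureLike.
Variables (R : realType) (m : nat) (M : smooth_manifold R m).
Notation V := (vfield M).
Implicit Types (X Y Z W : V) (T : V -> V -> V -> V -> cinf M).

Record curvature_like T : Prop := {
  like_linear : forall Y Z W, cinf_linear (fun X => T X Y Z W);
  like_skew12 : forall X Y Z W, T Y X Z W = - T X Y Z W;
  like_skew34 : forall X Y Z W, T X Y W Z = - T X Y Z W;
  like_bianchi : forall X Y Z W, T X Y Z W + T Y Z X W + T Z X Y W = 0 }.

Lemma curvature_like_lin f T T' : curvature_like T -> curvature_like T' ->
  curvature_like (fun X Y Z W => f * T X Y Z W + T' X Y Z W).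
Proof.
case=> lin s12 s34 b [lin' s12' s34' b'].
split=> [Y Z W h X X'|X Y Z W|X Y Z W|X Y Z W].
- rewrite lin lin'; ring.
- rewrite s12 s12'; ring.
- rewrite s34 s34'; ring.
- transitivity (f * (T X Y Z W + T Y Z X W + T Z X Y W)
    + (T' X Y Z W + T' Y Z X W + T' Z X Y W)); first by ring.
  by rewrite b b' mulr0 addr0.
Qed.

Definition kulkarni_nomizu (u v : V -> V -> cinf M) X Y Z W :=
  u Y Z * v X W + v Y Z * u X W - u X Z * v Y W - v X Z * u Y W.

Lemma kulkarni_nomizu_like u v :
  (forall Y, cinf_linear (u^~ Y)) -> (forall X Y, u X Y = u Y X) ->
  (forall Y, cinf_linear (v^~ Y)) -> (forall X Y, v X Y = v Y X) ->
  curvature_like (kulkarni_nomizu u v).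
Proof.
move=> linu symu linv symv; rewrite /kulkarni_nomizu.
split=> [Y Z W h X X'|X Y Z W|X Y Z W|X Y Z W].
- have lu U := linu U h X X'; have lv U := linv U h X X'.
  rewrite /= in lu lv; rewrite !lu !lv; ring.
- ring.
- ring.
- rewrite (symu Y X) (symu Z Y) (symu Z X) (symv Y X) (symv Z Y) (symv Z X); ring.
Qed.

(** The algebraic curvature tensor of a 2-form w; the last term restores the
    Bianchi identity, which the other two violate when w is skew. *)
Definition skew_curvature (w : V -> V -> cinf M) X Y Z W :=
  w Y Z * w X W - w X Z * w Y W - 2 * (w X Y * w Z W).

Lemma skew_curvature_like w :
  (forall Y, cinf_linear (w^~ Y)) -> (forall X Y, w X Y = - w Y X) ->
  curvature_like (skew_curvature w).
Proof.
move=> linw skeww; rewrite /skew_curvature.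
split=> [Y Z W h X X'|X Y Z W|X Y Z W|X Y Z W].
- have lw U := linw U h X X'.
  rewrite /= in lw; rewrite !lw; ring.
- rewrite (skeww Y X); ring.
- rewrite (skeww W Z); ring.
- rewrite (skeww Y X) (skeww Z Y) (skeww Z X); ring.
Qed.

Section Symmetries.
Variable T : V -> V -> V -> V -> cinf M.
Hypothesis TP : curvature_like T.

(** The octahedron argument: four instances of the Bianchi identity. *)
Lemma curvature_like_pair X Y Z W : T X Y Z W = T Z W X Y.
Proof.
have [_ s12 s34 b] := TP; apply: cinf_eq => p.
have bp A B C E := congr1 (fun f : cinf M => f p) (b A B C E).
have := bp X Y Z W; have := bp Y Z W X; have := bp Z W X Y; have := bp W X Y Z.
rewrite (s34 Y Z X W) (s34 Z W X Y) (s12 Y W Z X) (s12 X W Z Y) (s34 X W Y Z).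
rewrite (s12 Z X W Y) (s34 Z X Y W) (s12 X W Y Z) (s34 X Y Z W) (s34 Y W Z X).
eval_lra.
Qed.

Lemma like_linear2 X Z W : cinf_linear (fun Y => T X Y Z W).
Proof.
have [lin s12 _ _] := TP => f Y Y'; rewrite !(s12 _ X) lin; ring.
Qed.

Lemma like_linear3 X Y W : cinf_linear (fun Z => T X Y Z W).
Proof.
have [lin _ _ _] := TP => f Z Z'; rewrite !(curvature_like_pair X Y); exact: lin.
Qed.

Lemma like_linear4 X Y Z : cinf_linear (fun W => T X Y Z W).
Proof.
move=> f W W'; rewrite !(curvature_like_pair X Y); exact: like_linear2.
Qed.

End Symmetries.

End CurvatureLike.

Lemma curvature_curvature_like (R : realType) (m : nat)
    (M : smooth_manifold R m) (g : vfield M -> vfield M -> cinf M)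
    (nabla : vfield M -> vfield M -> vfield M) :
  pseudo_riemannian_metric g -> levi_civita g nabla ->
  curvature_like (fun X Y Z W => g (curvature nabla X Y Z) W).
Proof.
move=> gP nablaP; split=> [Y Z W|X Y Z W|X Y Z W|X Y Z W].
- exact: curvature_linear.
- by rewrite (curvature_skew12 nablaP Y) gNl.
- exact: curvature_skew34.
- by rewrite -!(gDl gP) (bianchi nablaP) g0l.
Qed.

(** * Covariant derivatives of endomorphisms *)

Section CovariantDerivative.
Variables (R : realType) (m : nat) (M : smooth_manifold R m).
Notation V := (vfield M).
Variables (g : V -> V -> cinf M) (nabla : V -> V -> V).
Hypotheses (gP : pseudo_riemannian_metric g) (nablaP : levi_civita g nabla).
Implicit Types (X Y Z W : V) (K : V -> V) (p : M).

(** Locked, so that rewriting with the additivity of g and nabla does not see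
    the difference in it; likewise for shape below. *)
Definition cov_der K X Y : V := locked (nabla X (K Y) - K (nabla X Y)).

Lemma cov_der_def K X Y : cov_der K X Y = nabla X (K Y) - K (nabla X Y).
Proof. by rewrite /cov_der -lock. Qed.

Definition endo_linear K := forall f X Y, K (f *: X + Y) = f *: K X + K Y.

Definition form K X Y := g (K X) Y.

Lemma form_linear K Y : endo_linear K -> cinf_linear ((form K)^~ Y).
Proof. by move=> linK f X X'; rewrite /form linK (gDl gP) (gZl gP). Qed.

Lemma cov_der_sym K X Y Z : (forall U W, g (K U) W = g U (K W)) ->
  g (cov_der K X Y) Z = g Y (cov_der K X Z).
Proof.
move=> symK; apply: cinf_eq => p.
have := congr1 (fun f : cinf M => f p) (congr1 X (symK Y Z)).
rewrite !(field_g nablaP) !cov_der_def !(gE gP) !evalE !symK; lra.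
Qed.

Lemma cov_der_skew K X Y Z : (forall U W, g (K U) W = - g U (K W)) ->
  g (cov_der K X Y) Z = - g Y (cov_der K X Z).
Proof.
move=> skewK; apply: cinf_eq => p.
have := congr1 (fun f : cinf M => f p) (congr1 X (skewK Y Z)).
rewrite field_funN !(field_g nablaP) !cov_der_def !(gE gP) !evalE !skewK; eval_lra.
Qed.

Lemma cov_der_g_linear_l K Y Z :
  endo_linear K -> cinf_linear (fun X => g (cov_der K X Y) Z).
Proof.
move=> linK f X X'; rewrite -(gZl gP) -(gDl gP) !cov_der_def !(nablaE nablaP).
by rewrite linK; congr (g _ Z); field_ring.
Qed.

Lemma cov_der_g_linear_r K X Z :
  endo_linear K -> cinf_linear (fun Y => g (cov_der K X Y) Z).
Proof.
move=> linK f Y Y'; have KD U W : K (U + W) = K U + K W.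
  by have := linK 1 U W; rewrite !scale1r.
have K0 : K 0 = 0 by apply: (addrI (K 0)); rewrite -KD !addr0.
have KZ h W : K (h *: W) = h *: K W by have := linK h W 0; rewrite K0 !addr0.
rewrite -(gZl gP) -(gDl gP) !cov_der_def !(nablaE nablaP) !(KD, KZ).
by rewrite !(nablaE nablaP); congr (g _ Z); field_ring.
Qed.

Lemma ricci_identity K X Y Z : {morph K : U W / U - W} ->
  curvature nabla X Y (K Z) - K (curvature nabla X Y Z) =
  (nabla X (cov_der K Y Z) - cov_der K (nabla X Y) Z - cov_der K Y (nabla X Z))
  - (nabla Y (cov_der K X Z) - cov_der K (nabla Y X) Z
     - cov_der K X (nabla Y Z)).
Proof.
move=> addK; rewrite /curvature !cov_der_def !addK.
rewrite (lie_nabla nablaP) !(nablaE nablaP) !addK; field_ring.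
Qed.

Lemma ricci_identity_g K X Y Z W p : {morph K : U U' / U - U'} ->
  g (curvature nabla X Y (K Z)) W p - g (K (curvature nabla X Y Z)) W p =
  (g (nabla X (cov_der K Y Z)) W p - g (cov_der K (nabla X Y) Z) W p
   - g (cov_der K Y (nabla X Z)) W p)
  - (g (nabla Y (cov_der K X Z)) W p - g (cov_der K (nabla Y X) Z) W p
     - g (cov_der K X (nabla Y Z)) W p).
Proof.
move=> addK; have gB A B : g A W p - g B W p = g (A - B) W p.
  by rewrite (gDl gP) (gNl gP).
by rewrite !gB (ricci_identity X Y Z addK).
Qed.

End CovariantDerivative.

(** * Contraction along an orthonormal frame *)

Section Contraction.
Variables (R : realType) (m : nat) (M : smooth_manifold R m).
Notation V := (vfield M).
Notation cst := (cinf_cst M).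
Variables (g : V -> V -> cinf M) (E : 'I_m -> V) (q : M).
Hypothesis gP : pseudo_riemannian_metric g.
Implicit Types (X Y Z W : V) (B : V -> V -> cinf M).

Definition contraction B : R := \sum_i g (E i) (E i) q * B (E i) (E i) q.

Lemma contraction_lin c B B' :
  contraction (fun X Y => cst c * B X Y + B' X Y) =
  c * contraction B + contraction B'.
Proof.
rewrite /contraction mulr_sumr -big_split; apply: eq_bigr => i _.
by rewrite -[X in _ * X]/(c * B (E i) (E i) q + B' (E i) (E i) q) mulrDr mulrCA.
Qed.

Hypothesis Enorm : forall i, g (E i) (E i) q = 1 \/ g (E i) (E i) q = -1.
Hypothesis Eexp : forall T X, cinf_linear T ->
  T X q = \sum_i g (E i) (E i) q * g X (E i) q * T (E i) q.

Lemma contraction_metric : contraction g = m%:R.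
Proof.
rewrite /contraction (eq_bigr (fun=> 1)) => [|i _].
  by rewrite sumr_const card_ord.
by have [] := Enorm i => ->; ring.
Qed.

Lemma contraction_mul X B : cinf_linear (B^~ X) -> forall Y,
  \sum_i g (E i) (E i) q * (g Y (E i) q * B (E i) X q) = B Y X q.
Proof.
by move=> linB Y; rewrite (Eexp Y linB); apply: eq_bigr => i _; rewrite mulrA.
Qed.

Lemma contraction_comm (U U' : V -> V) : endo_linear U -> endo_linear U' ->
  contraction (form g (U \o U')) = contraction (form g (U' \o U)).
Proof.
have expand (K K' : V -> V) : endo_linear K -> contraction (form g (K \o K')) =
    \sum_i \sum_j g (E i) (E i) q * g (E j) (E j) q *
      (g (K' (E i)) (E j) q * g (K (E j)) (E i) q).
  move=> linK; apply: eq_bigr => i _; rewrite /form /=.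
  rewrite -[g (K (K' (E i))) (E i)]/(form g K (K' (E i)) (E i)).
  rewrite (Eexp _ (form_linear gP _ linK)) mulr_sumr.
  by apply: eq_bigr => j _; rewrite /form; ring.
move=> linU linU'; rewrite !expand// exchange_big.
by apply: eq_bigr => i _; apply: eq_bigr => j _; ring.
Qed.

Lemma contraction_opp U :
  contraction (form g (fun X => - U X)) = - contraction (form g U).
Proof.
rewrite /contraction -sumrN; apply: eq_bigr => i _.
by rewrite /form (gNl gP) -mulrN.
Qed.

Lemma contraction_kulkarni_nomizu U U' X W : endo_linear U -> endo_linear U' ->
  contraction (fun Y Z => kulkarni_nomizu (form g U) (form g U') X Y Z W) =
  contraction (form g U) * form g U' X W q
  + contraction (form g U') * form g U X W q
  - form g U' (U X) W q - form g U (U' X) W q.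
Proof.
move=> linU linU'.
rewrite -(contraction_mul (form_linear gP W linU') (U X)).
rewrite -(contraction_mul (form_linear gP W linU) (U' X)).
rewrite /contraction !mulr_suml -!sumrN -!big_split; apply: eq_bigr => i _.
by rewrite /kulkarni_nomizu /form; generalize_evals => /=; ring.
Qed.

Lemma contraction_skew_curvature U X W : endo_linear U ->
  (forall X, form g U X X = 0) ->
  contraction (fun Y Z => skew_curvature (form g U) X Y Z W) =
  - 3 * form g U (U X) W q.
Proof.
move=> linU U0; rewrite -(contraction_mul (form_linear gP W linU) (U X)) mulr_sumr.
apply: eq_bigr => i _; rewrite /skew_curvature U0 /form; eval_ring.
Qed.

End Contraction.

(** * Paracontact metric structures *)

Section Paracontact.
Variables (R : realType) (n : nat) (M : smooth_manifold R n.*2.+1).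
Notation V := (vfield M).
Notation cst := (cinf_cst M).
Variables (phi : {linear V -> V}) (xi : V) (eta : {linear V -> (cinf M)^o}).
Variables (g : V -> V -> cinf M) (nabla : V -> V -> V).
Hypotheses (pcP : paracontact_metric phi xi eta g) (nablaP : levi_civita g nabla).
Implicit Types (X Y Z W : V) (p : M).

Let gP : pseudo_riemannian_metric g. Proof. by have [] := pcP. Qed.

Lemma eta_xi : eta xi = 1. Proof. by have [[]] := pcP. Qed.

Lemma etaZ f X : eta (f *: X) = f * eta X. Proof. by rewrite linearZ. Qed.

Lemma phi_phi_eta X : phi (phi X) = X - eta X *: xi.
Proof. by have [[]] := pcP. Qed.

Lemma phi0 : phi 0 = 0. Proof. exact: linear0. Qed.
Lemma phiD X Y : phi (X + Y) = phi X + phi Y. Proof. exact: linearD. Qed.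
Lemma phiN X : phi (- X) = - phi X. Proof. exact: linearN. Qed.
Lemma phiZ f X : phi (f *: X) = f *: phi X. Proof. exact: linearZ. Qed.
Lemma phi_linear : endo_linear phi. Proof. by move=> f X Y; rewrite phiD phiZ. Qed.
Definition phiE := (phiD, phiN, phiZ, phi0).

Lemma phi_xi : phi xi = 0.
Proof.
have e0 : phi (phi xi) = 0 by rewrite phi_phi_eta eta_xi scale1r subrr.
have := phi_phi_eta (phi xi); rewrite e0 linear0 => /esym/subr0_eq.
move: (eta (phi xi)) => a e1; suff a0 : a = 0 by rewrite e1 a0 scale0r.
have : eta (phi (phi xi)) = a * a by rewrite e1 phiZ e1 !etaZ eta_xi mulr1.
rewrite e0 linear0 => aa0; apply: cinf_eq => p.
have /esym/eqP := congr1 (fun f : cinf M => f p) aa0.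
by rewrite evalM mulf_eq0 orbb => /eqP.
Qed.

Lemma eta_phi X : eta (phi X) = 0.
Proof.
have := phi_phi_eta (phi X); rewrite (phi_phi_eta X) !phiE phi_xi.
rewrite scaler0 subr0.
move=> /eqP; rewrite -subr_eq0 opprB addrC subrK => /eqP/(congr1 eta).
by rewrite etaZ eta_xi mulr1 linear0.
Qed.

Lemma eta_g X : eta X = g X xi.
Proof.
have [_ _ comp _] := pcP; have := comp X xi.
rewrite phi_xi (g0r gP) eta_xi mulr1 => /esym/eqP.
by rewrite addrC subr_eq0 => /eqP.
Qed.

Lemma g_xi_xi : g xi xi = 1. Proof. by rewrite -eta_g eta_xi. Qed.

Lemma phi_phi X : phi (phi X) = X - g X xi *: xi.
Proof. by rewrite phi_phi_eta eta_g. Qed.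

Lemma g_phi_xi X : g (phi X) xi = 0. Proof. by rewrite -eta_g eta_phi. Qed.

Lemma phi_skew X Y : g (phi X) Y = - g X (phi Y).
Proof.
have [_ _ comp _] := pcP; have := comp X (phi Y).
by rewrite phi_phi !(gE gP) g_phi_xi eta_phi !mulr0 oppr0 !addr0.
Qed.

(** The symmetric part of nabla xi, whose skew part is -phi. It determines h as
    phi S and, unlike h, it has real eigenvalues when kappa < -1. *)
Definition shape X : V := locked (nabla X xi + phi X).
Local Notation S := shape.
Local Notation D := (cov_der nabla).
Local Notation Rm := (curvature nabla).

Lemma shape_def X : S X = nabla X xi + phi X.
Proof. by rewrite /shape -lock. Qed.

Lemma nabla_xi X : nabla X xi = S X - phi X.
Proof. by rewrite shape_def addrK. Qed.

Lemma shapeD X Y : S (X + Y) = S X + S Y.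
Proof. by rewrite !shape_def (nablaE nablaP) phiD; field_ring. Qed.
Lemma shapeZ f X : S (f *: X) = f *: S X.
Proof. by rewrite !shape_def (nablaE nablaP) phiZ scalerDr. Qed.
Lemma shape0 : S 0 = 0.
Proof. by rewrite !shape_def (nablaE nablaP) linear0 addr0. Qed.
Lemma shapeN X : S (- X) = - S X.
Proof. by rewrite -scaleN1r shapeZ scaleN1r. Qed.
Lemma shape_linear : endo_linear S.
Proof. by move=> f X Y; rewrite shapeD shapeZ. Qed.
Definition shapeE := (shapeD, shapeN, shapeZ, shape0).

Lemma g_nabla_xi_xi X : g (nabla X xi) xi = 0.
Proof.
apply: cinf_eq => p.
have := congr1 (fun f : cinf M => f p) (field_g nablaP xi xi X).
rewrite g_xi_xi field_fun1 (gC gP xi); eval_lra.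
Qed.

Lemma nabla_xi_skew X Y p :
  g (nabla X xi) Y p - g (nabla Y xi) X p = 2 * g X (phi Y) p.
Proof.
have [_ _ _ contact] := pcP.
have := congr1 (fun f : cinf M => f p) (contact X Y).
rewrite /exterior_derivative !eta_g (lie_nabla nablaP) !(field_g nablaP).
rewrite !(gE gP) !evalE.
rewrite (gC gP Y) (gC gP X (nabla _ _)); lra.
Qed.

Lemma shape_sym X Y : g (S X) Y = g X (S Y).
Proof.
apply: cinf_eq => p; have := nabla_xi_skew X Y p.
rewrite !shape_def !(gE gP) !evalE phi_skew !evalE (gC gP X (nabla _ _)); lra.
Qed.

Lemma shape_xi : S xi = 0.
Proof.
apply: (g_eq gP) => p Y; have := nabla_xi_skew xi Y p.
rewrite g_nabla_xi_xi (gC gP xi (phi Y)) g_phi_xi shape_def phi_xi addr0.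
rewrite (g0l gP); eval_lra.
Qed.

Lemma g_shape_xi X : g (S X) xi = 0.
Proof. by rewrite shape_sym shape_xi (g0r gP). Qed.

Lemma nabla_xi_xi : nabla xi xi = 0.
Proof. by rewrite nabla_xi shape_xi phi_xi subrr. Qed.

Lemma cov_der_phi_skew X Y Z : g (D phi X Y) Z = - g (D phi X Z) Y.
Proof. by rewrite (cov_der_skew gP nablaP _ _ _ phi_skew) (gC gP Y). Qed.

Lemma cov_der_shape_sym X Y Z : g (D S X Y) Z = g (D S X Z) Y.
Proof. by rewrite (cov_der_sym gP nablaP _ _ _ shape_sym) (gC gP Y). Qed.

Lemma curvature_xi X Y :
  Rm X Y xi = (D S X Y - D phi X Y) - (D S Y X - D phi Y X).
Proof.
rewrite /curvature (lie_nabla nablaP) !nabla_xi !(nablaE nablaP) !cov_der_def.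
by rewrite !shapeE !phiE; field_ring.
Qed.

(** The 2-form g (_, phi _) is closed, being d eta. This comes from summing
    g (R (X, Y) xi, Z) cyclically: the sum is zero by Bianchi, and the symmetric
    endomorphisms nabla S drop out of it. *)
Lemma cov_der_phi_cyclic X Y Z p :
  g (D phi X Y) Z p + g (D phi Y Z) X p + g (D phi Z X) Y p = 0.
Proof.
have := congr1 (fun W => g W xi p) (bianchi nablaP X Y Z).
rewrite 2!(gDl gP) (g0l gP) !evalE.
rewrite !(curvature_skew34 gP nablaP _ _ _ xi) !curvature_xi !(gE gP) !evalE.
rewrite (cov_der_shape_sym X Z) (cov_der_shape_sym Y Z) (cov_der_shape_sym Z Y).
rewrite (cov_der_phi_skew Y X) (cov_der_phi_skew Z Y) (cov_der_phi_skew X Z).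
eval_lra.
Qed.

Lemma cov_der_phi_xi_r X : D phi X xi = - phi (S X) + X - g X xi *: xi.
Proof.
rewrite cov_der_def phi_xi (nablaE nablaP) nabla_xi !phiE phi_phi; field_ring.
Qed.

Lemma cov_der_phi2 X Y : D phi X (phi Y) + phi (D phi X Y) =
  - (g Y (nabla X xi) *: xi) - g Y xi *: nabla X xi.
Proof.
rewrite !cov_der_def !phiE !phi_phi !(nablaE nablaP).
by rewrite (field_g nablaP); field_ring.
Qed.

(** Closedness of d eta with one argument equal to xi. *)
Lemma cov_der_phi_xi_shape Y : D phi xi Y = - S (phi Y) - phi (S Y).
Proof.
apply: (g_eq gP) => p Z; have := cov_der_phi_cyclic xi Y Z p.
rewrite (cov_der_phi_skew Y Z) !cov_der_phi_xi_r !(gE gP) !evalE.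
rewrite (phi_skew (S Z)) (shape_sym Z) (gC gP Z (S _)) (gC gP Z Y).
rewrite !(gC gP xi); eval_lra.
Qed.

Lemma phi_phi_shape X : phi (phi (S X)) = S X.
Proof. by rewrite phi_phi g_shape_xi scale0r subr0. Qed.

Lemma shape_phi_phi X : S (phi (phi X)) = S X.
Proof. by rewrite phi_phi !shapeE shape_xi scaler0 subr0. Qed.

(** Differentiating phi^2 = I - eta (x) xi along the geodesic field xi gives
    phi S phi = - S. *)
Lemma shape_phi X : S (phi X) = - phi (S X).
Proof.
have := cov_der_phi2 xi X.
rewrite nabla_xi_xi (g0r gP) !cov_der_phi_xi_shape scaler0 scale0r subr0 oppr0.
rewrite !phiE shape_phi_phi phi_phi_shape => e.
have : phi (S (phi X)) = - S X.
  apply: vfield_eq_at => f p; have := congr1 (fun W : V => W f p) e.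
  rewrite !fieldE; eval_lra.
by move=> /(congr1 phi); rewrite phiN phi_phi g_shape_xi scale0r subr0.
Qed.

Lemma cov_der_phi_xi X : D phi xi X = 0.
Proof. by rewrite cov_der_phi_xi_shape shape_phi opprK subrr. Qed.

Lemma h_tensorE X : h_tensor phi xi X = phi (S X).
Proof.
rewrite /h_tensor /lie_derivative !(lie_nabla nablaP) !phiE.
have := cov_der_phi_xi X; rewrite cov_der_def => /subr0_eq ->.
rewrite !nabla_xi !phiE shape_phi; field_lra.
Qed.

(** * Consequences of the nullity condition *)

Variables (kappa mu : R).
Hypothesis nullityP : kappa_mu_condition phi xi eta nabla kappa mu.
Hypothesis kappa_lt : kappa < -1.

Let lambda2_gt0 : 0 < -1 - kappa. Proof. by have := kappa_lt; lra. Qed.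

Lemma curvature_xi_nullity X Y : Rm X Y xi =
  cst kappa *: (g Y xi *: X - g X xi *: Y)
  + cst mu *: (g Y xi *: phi (S X) - g X xi *: phi (S Y)).
Proof. by rewrite nullityP !h_tensorE !eta_g. Qed.

(** The covariant derivative of S phi = - phi S. *)
Lemma cov_der_shape_phi Y Z :
  D S Y (phi Z) = - phi (D S Y Z) - D phi Y (S Z) - S (D phi Y Z).
Proof.
have e W : S (phi W) = - phi (S W) by exact: shape_phi.
rewrite !cov_der_def !phiE !shapeE !e !(nablaE nablaP); field_ring.
Qed.

Lemma cov_der_shape_xi_r X : D S X xi = - S (S X) - phi (S X).
Proof.
rewrite cov_der_def shape_xi nabla_xi (nabla0r nablaP) !shapeE shape_phi; field_ring.
Qed.

(** The nullity condition for R (X, xi) xi. The first two summands commute with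
    phi and the last two anticommute with it, so that both halves vanish. *)
Lemma nullity_split X :
  S (S X) + cst (1 + kappa) *: phi (phi X) + D S xi X + cst mu *: phi (S X) = 0.
Proof.
have := curvature_xi_nullity X xi.
rewrite curvature_xi cov_der_phi_xi cov_der_shape_xi_r cov_der_phi_xi_r.
rewrite g_xi_xi shape_xi phi0 phi_phi => e.
apply: vfield_eq_at => f p; have := congr1 (fun W : V => W f p) e.
rewrite !fieldE; eval_lra.
Qed.

Lemma shape_shape X : S (S X) = cst (-1 - kappa) *: phi (phi X).
Proof.
have e1 := congr1 phi (nullity_split X); have := nullity_split (phi X).
rewrite cov_der_shape_phi !cov_der_phi_xi !shapeE !shape_phi shapeE shape_phi.
move=> e2.
rewrite !phiE in e1; rewrite phiN in e2.
suff : phi (S (S X)) = cst (-1 - kappa) *: phi (phi (phi X)).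
  move=> /(congr1 phi); rewrite phiZ phi_phi_shape => ->; congr (_ *: _).
  by rewrite [LHS]phi_phi g_phi_xi scale0r subr0.
apply: vfield_eq_at => f p; have := congr1 (fun W : V => W f p) e1.
have := congr1 (fun W : V => W f p) e2.
rewrite !fieldE; eval_lra.
Qed.

Lemma cov_der_shape_xi X : D S xi X = - (cst mu *: phi (S X)).
Proof.
apply: vfield_eq_at => f p.
have := congr1 (fun W : V => W f p) (nullity_split X).
rewrite shape_shape !fieldE; eval_lra.
Qed.

Lemma phi_phi_hor X : g X xi = 0 -> phi (phi X) = X.
Proof. by move=> X0; rewrite phi_phi X0 scale0r subr0. Qed.

(** On ker eta, where phi^2 = 1, nabla phi anticommutes with phi. *)
Lemma cov_der_phi_transfer X Y Z p : g Y xi = 0 -> g Z xi = 0 ->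
  g (D phi X (phi Y)) Z p = g (D phi X Y) (phi Z) p.
Proof.
move=> Y0 Z0; have := congr1 (fun W => g W Z p) (cov_der_phi2 X Y).
rewrite !(gE gP) Y0 (gC gP xi) Z0 phi_skew; eval_lra.
Qed.

(** As for almost Kaehler structures, closedness at the four triples obtained by
    applying phi to an even number of arguments gives this symmetry. *)
Lemma cov_der_phi_phi_phi X Y Z p : g X xi = 0 -> g Y xi = 0 -> g Z xi = 0 ->
  g (D phi (phi X) (phi Y)) Z p = g (D phi X Y) Z p.
Proof.
move=> X0 Y0 Z0; have cyc := cov_der_phi_cyclic.
have := cyc X Y Z p; have := cyc X (phi Y) (phi Z) p.
have := cyc (phi X) Y (phi Z) p; have := cyc (phi X) (phi Y) Z p.
have tr := cov_der_phi_transfer; have pp := phi_phi_hor; have gp := g_phi_xi.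
rewrite (tr X Y (phi Z))// (pp Z)// -(tr (phi Z) X Y)// -(tr (phi X) Y Z)//.
rewrite (tr Y Z (phi X))// (pp X)// -(tr (phi Y) Z X)// (tr Z X (phi Y))// (pp Y)//.
lra.
Qed.

Lemma cov_der_phi_move X Y Z p : g X xi = 0 -> g Y xi = 0 -> g Z xi = 0 ->
  g (D phi (phi X) Y) Z p = g (D phi X (phi Y)) Z p.
Proof.
move=> X0 Y0 Z0; rewrite -{1}(phi_phi_hor Y0) cov_der_phi_phi_phi//.
exact: g_phi_xi.
Qed.

(** R (Y, Z) xi is zero for Y and Z in ker eta. *)
Lemma codazzi X Y Z p : g X xi = 0 -> g Y xi = 0 -> g Z xi = 0 ->
  g (D S Y Z) X p - g (D phi Y Z) X p = g (D S Z Y) X p - g (D phi Z Y) X p.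
Proof.
move=> X0 Y0 Z0; have := congr1 (fun W => g W X p) (curvature_xi_nullity Y Z).
rewrite Y0 Z0 !scale0r !subrr !scaler0 addr0 curvature_xi !(gE gP); eval_lra.
Qed.

Lemma cov_der_shape_phi_g X Y Z p :
  g (D S Y (phi Z)) X p - g (D S Y Z) (phi X) p
  + g (D phi Y (S Z)) X p + g (D phi Y Z) (S X) p = 0.
Proof.
rewrite cov_der_shape_phi !(gE gP) phi_skew shape_sym; eval_lra.
Qed.

(** Summing the Codazzi equations at the four triples obtained by applying phi
    to an even number of arguments, with a minus sign where phi is applied to the
    vector that g pairs with the derivatives, cancels nabla S. This leaves
    nabla_(phi S X) phi = 0 on ker eta, where S is invertible. *)
Lemma cov_der_phi_hor X Y Z : g X xi = 0 -> g Y xi = 0 -> g Z xi = 0 ->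
  g (D phi X Y) Z = 0.
Proof.
have linphi := phi_linear.
have key U p : g U xi = 0 -> g Y xi = 0 -> g Z xi = 0 ->
    g (D phi (phi (S U)) Y) Z p = 0.
  move=> X0 Y0 Z0.
  have gp := g_phi_xi; have gs := g_shape_xi; have tr := cov_der_phi_transfer.
  have mv := cov_der_phi_move.
  have := codazzi p X0 Y0 Z0.
  have := codazzi p X0 (gp Y) (gp Z).
  have := codazzi p (gp U) Y0 (gp Z).
  have := codazzi p (gp U) (gp Y) Z0.
  have := cov_der_shape_phi_g (phi U) Y Z p.
  have := cov_der_shape_phi_g (phi U) Z Y p.
  have := cov_der_shape_phi_g U (phi Y) Z p.
  have := cov_der_shape_phi_g U (phi Z) Y p.
  have := cov_der_phi_cyclic (phi (S U)) Y Z p.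
  have := (tr Y (S Z) U p (gs Z) X0, mv Y (S Z) U p Y0 (gs Z) X0).
  have := (tr Z (S Y) U p (gs Y) X0, mv Z (S Y) U p Z0 (gs Y) X0).
  have := (tr Y Z (S U) p Z0 (gs U), mv Y Z (S U) p Y0 Z0 (gs U)).
  have := (tr Z Y (S U) p Y0 (gs U), mv Z Y (S U) p Z0 Y0 (gs U)).
  have := (tr Y Z (phi U) p Z0 (gp U), mv Y Z (phi U) p Y0 Z0 (gp U)).
  have := (tr Z Y (phi U) p Y0 (gp U), mv Z Y (phi U) p Z0 Y0 (gp U)).
  rewrite (cov_der_phi_phi_phi p Y0 Z0 X0) (cov_der_phi_phi_phi p Z0 Y0 X0).
  rewrite (cov_der_phi_skew Z (phi (S U))) (phi_phi_hor X0) (shape_phi U).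
  rewrite !(gNr gP) !evalE.
  do 6![case=> ? ?]; lra.
move=> X0 Y0 Z0; apply: cinf_eq => p.
have := key (S (phi X)) p (g_shape_xi _) Y0 Z0.
rewrite shape_shape phiZ !(phi_phi_hor (g_phi_xi _)) (phi_phi_hor X0).
rewrite (cinf_linearZ (cov_der_g_linear_l gP nablaP Y Z linphi)) !evalE => /eqP.
by rewrite mulf_eq0 (gt_eqF lambda2_gt0) => /eqP.
Qed.

(** As nabla phi is zero on ker eta, the Codazzi equation makes
    g ((nabla_X S) Y, Z) totally symmetric, while the derivative of
    S^2 = (-1 - kappa) phi^2 makes it change sign when S moves from Y to Z.
    So it vanishes once some argument is in the image of S. *)
Lemma cov_der_shape_hor X Y Z : g X xi = 0 -> g Y xi = 0 -> g Z xi = 0 ->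
  g (D S X Y) Z = 0.
Proof.
move=> X0 Y0 Z0; have linS := shape_linear.
have gs := g_shape_xi.
have sym U W T p : g U xi = 0 -> g W xi = 0 -> g T xi = 0 ->
    g (D S U W) T p = g (D S W U) T p.
  move=> U0 W0 T0; have := codazzi p T0 U0 W0.
  by rewrite !cov_der_phi_hor// !evalE !subr0.
have anti U W T p : g U xi = 0 -> g W xi = 0 -> g T xi = 0 ->
    g (D S U (S W)) T p = - g (D S U W) (S T) p.
  move=> U0 W0 T0.
  have : D S U (S W) + S (D S U W) =
      cst (-1 - kappa) *: (D phi U (phi W) + phi (D phi U W)).
    rewrite !cov_der_def !shapeE phiD phiN !shape_shape (nablaE nablaP).
    by field_ring.
  move=> /(congr1 (fun W' => g W' T p)).
  rewrite cov_der_phi2 !(gE gP) shape_sym W0 (gC gP xi) T0; eval_lra.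
apply: cinf_eq => p; have : g (D S (S (S X)) Y) Z p = 0.
  have e1 : g (D S (S (S X)) Y) Z p = g (D S (S X) (S Y)) Z p.
    rewrite (sym _ _ _ p (gs _) Y0 Z0) (anti _ _ _ p Y0 (gs X) Z0).
    by rewrite -(sym _ _ _ p (gs X) Y0 (gs Z)) (anti _ _ _ p (gs X) Y0 Z0).
  have e2 : g (D S (S (S X)) Y) Z p = g (D S (S X) Y) (S Z) p.
    rewrite (cov_der_shape_sym _ Y) (sym _ _ _ p (gs _) Z0 Y0).
    rewrite (anti _ _ _ p Z0 (gs X) Y0) -(sym _ _ _ p (gs X) Z0 (gs Y)).
    by rewrite -(anti _ _ _ p (gs X) Z0 Y0) (cov_der_shape_sym _ (S Z)).
  have := anti _ _ _ p (gs X) Y0 Z0; lra.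
rewrite shape_shape (phi_phi_hor X0).
rewrite (cinf_linearZ (cov_der_g_linear_l gP nablaP Y Z linS)) !evalE => /eqP.
by rewrite mulf_eq0 (gt_eqF lambda2_gt0) => /eqP.
Qed.

Lemma hor_split T X : cinf_linear T -> T X = g X xi * T xi + T (phi (phi X)).
Proof.
by move=> linT; rewrite -linT phi_phi; congr T; field_ring.
Qed.

(** Only components along xi are left, and those are obtained by differentiating
    phi xi = 0; below, S xi = 0. *)
Lemma cov_der_phiE Y Z : D phi Y Z =
  g (phi (S Y) - phi (phi Y)) Z *: xi - g Z xi *: (phi (S Y) - phi (phi Y)).
Proof.
have linphi := phi_linear.
have hor0 := g_phi_xi.
apply: (g_eq gP) => p W.
rewrite (hor_split Z (cov_der_g_linear_r gP nablaP Y W linphi)).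
rewrite (gC gP (D phi Y (phi (phi Z)))) (hor_split W (g_linear gP _)).
rewrite !(gC gP _ (D phi _ _)).
rewrite (hor_split Y (cov_der_g_linear_l gP nablaP (phi (phi Z))
  (phi (phi W)) linphi)).
rewrite cov_der_phi_xi (g0l gP) (cov_der_phi_hor (hor0 _) (hor0 _) (hor0 _)).
rewrite (cov_der_phi_skew _ _ xi).
rewrite !cov_der_phi_xi_r !phi_phi !(gE gP) g_phi_xi g_xi_xi.
rewrite (gC gP xi W) (gC gP xi Z).
eval_ring.
Qed.

Lemma cov_der_shapeE Y Z : D S Y Z =
  - ((cst mu * g Y xi) *: phi (S Z)) - g Z xi *: (S (S Y) + phi (S Y))
  - g (S (S Y) + phi (S Y)) Z *: xi.
Proof.
have linS := shape_linear.
have hor0 := g_phi_xi.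
apply: (g_eq gP) => p W.
rewrite (hor_split Z (cov_der_g_linear_r gP nablaP Y W linS)).
rewrite (gC gP (D S Y (phi (phi Z)))) (hor_split W (g_linear gP _)).
rewrite !(gC gP _ (D S _ _)).
rewrite (hor_split Y (cov_der_g_linear_l gP nablaP (phi (phi Z))
  (phi (phi W)) linS)).
rewrite cov_der_shape_xi (cov_der_shape_hor (hor0 _) (hor0 _) (hor0 _)).
rewrite (cov_der_shape_sym _ _ xi).
rewrite shape_phi_phi !cov_der_shape_xi_r !phi_phi !(gE gP) !g_phi_xi g_shape_xi.
rewrite (gC gP xi W).
eval_ring.
Qed.

(** * Commutators of the curvature with phi and S *)

Lemma g_nabla_hor X Z : g Z xi = 0 -> g (nabla X Z) xi = - g Z (nabla X xi).
Proof.
move=> Z0; have := field_g nablaP Z xi X.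
by rewrite Z0 field_fun0 => /esym/eqP; rewrite addr_eq0 => /eqP.
Qed.

(** The Ricci identity for phi, whose covariant derivative is explicit. *)
Lemma curvature_phi X Y Z W p :
  g X xi = 0 -> g Y xi = 0 -> g Z xi = 0 -> g W xi = 0 ->
  g (Rm X Y (phi Z)) W p + g (Rm X Y Z) (phi W) p =
  (g (phi (S Y)) Z p - g Y Z p) * (g (S X) W p - g (phi X) W p)
  - (g (S X) Z p - g (phi X) Z p) * (g (phi (S Y)) W p - g Y W p)
  - ((g (phi (S X)) Z p - g X Z p) * (g (S Y) W p - g (phi Y) W p)
     - (g (S Y) Z p - g (phi Y) Z p) * (g (phi (S X)) W p - g X W p)).
Proof.
move=> X0 Y0 Z0 W0.
have phiB : {morph phi : U U' / U - U'} by move=> U U'; rewrite !phiE.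
have := ricci_identity_g gP nablaP X Y Z W p phiB.
have xiW : g xi W = 0 by rewrite (gC gP).
have nab U U' : g U' xi = 0 -> g (nabla U (D phi U' Z)) W p =
    (g (phi (S U')) Z p - g U' Z p) * (g (S U) W p - g (phi U) W p).
  move=> U0; rewrite cov_der_phiE Z0 scale0r subr0 (nablaZr nablaP) nabla_xi.
  rewrite (phi_phi_hor U0) !(gE gP) xiW; eval_ring.
have der0 U : g (D phi U Z) W p = 0.
  by rewrite cov_der_phiE Z0 scale0r subr0 (gZl gP) xiW !evalE mulr0.
have der U U' : g U' xi = 0 -> g (D phi U' (nabla U Z)) W p =
    (g (S U) Z p - g (phi U) Z p) * (g (phi (S U')) W p - g U' W p).
  move=> U0; rewrite cov_der_phiE (g_nabla_hor _ Z0) nabla_xi (phi_phi_hor U0).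
  rewrite !(gE gP) xiW (gC gP Z (S U)) (gC gP Z (phi U)); eval_ring.
rewrite !nab// !der// !der0 phi_skew; eval_lra.
Qed.

(** The Ricci identity for S, whose covariant derivative is explicit. *)
Lemma curvature_shape X Y Z W p :
  g X xi = 0 -> g Y xi = 0 -> g Z xi = 0 -> g W xi = 0 ->
  g (Rm X Y (S Z)) W p - g (Rm X Y Z) (S W) p =
  - 2 * mu * g X (phi Y) p * g (phi (S Z)) W p
  - ((g (S X) Z p - g (phi X) Z p) * (g (S (S Y)) W p + g (phi (S Y)) W p)
     + (g (S (S Y)) Z p + g (phi (S Y)) Z p) * (g (S X) W p - g (phi X) W p))
  + ((g (S Y) Z p - g (phi Y) Z p) * (g (S (S X)) W p + g (phi (S X)) W p)
     + (g (S (S X)) Z p + g (phi (S X)) Z p) * (g (S Y) W p - g (phi Y) W p)).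
Proof.
move=> X0 Y0 Z0 W0.
have shapeB : {morph S : U U' / U - U'} by move=> U U'; rewrite !shapeE.
have := ricci_identity_g gP nablaP X Y Z W p shapeB.
have xiW : g xi W = 0 by rewrite (gC gP).
have nab U U' : g U' xi = 0 -> g (nabla U (D S U' Z)) W p =
    - (g (S (S U')) Z p + g (phi (S U')) Z p) * (g (S U) W p - g (phi U) W p).
  move=> U0; rewrite cov_der_shapeE Z0 U0 mulr0 !scale0r oppr0 add0r sub0r.
  rewrite (nablaNr nablaP) (nablaZr nablaP) nabla_xi.
  rewrite !(gE gP) xiW; eval_ring.
have der0 U U' : g U' xi = 0 -> g (D S (nabla U U') Z) W p =
    mu * (g (S U) U' p - g (phi U) U' p) * g (phi (S Z)) W p.
  move=> U0; rewrite cov_der_shapeE Z0 scale0r (g_nabla_hor _ U0) nabla_xi.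
  rewrite !(gE gP) xiW (gC gP U' (S U)) (gC gP U' (phi U)); eval_ring.
have der U U' : g U' xi = 0 -> g (D S U' (nabla U Z)) W p =
    (g (S U) Z p - g (phi U) Z p)
      * (g (S (S U')) W p + g (phi (S U')) W p).
  move=> U0; rewrite cov_der_shapeE U0 (g_nabla_hor _ Z0) nabla_xi mulr0.
  rewrite !(gE gP) xiW (gC gP Z (S U)) (gC gP Z (phi U)); eval_ring.
rewrite !nab// !der// !der0// (shape_sym (Rm X Y Z)) (shape_sym Y X).
rewrite (phi_skew Y X) (gC gP Y (S X)) (gC gP Y (phi X)) (phi_skew X Y) !evalE.
lra.
Qed.

(** * The curvature tensor is determined by kappa and mu *)

Let lambda := Num.sqrt (-1 - kappa).

Let lambda_gt0 : 0 < lambda. Proof. by rewrite sqrtr_gt0. Qed.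

Let lambda2 : lambda ^+ 2 = -1 - kappa.
Proof. by rewrite sqr_sqrtr// ltW. Qed.

Definition shape_eigen (e : bool) X :=
  g X xi = 0 /\ S X = cst ((-1) ^+ e * lambda) *: X.

Lemma shape_eigen_phi e X : shape_eigen e X -> shape_eigen (~~ e) (phi X).
Proof.
case=> X0 SX; split; first exact: g_phi_xi.
rewrite shape_phi SX phiZ; case: e {SX} => /=; rewrite ?expr0 ?expr1; field_ring.
Qed.

(** A horizontal field Y is a multiple of the difference of the eigenfields
    lambda Y + S Y and - lambda Y + S Y. *)
Lemma eigen_eq0 (T : V -> cinf M) X : cinf_linear T -> T xi = 0 ->
  (forall e Y, shape_eigen e Y -> T Y = 0) -> T X = 0.
Proof.
move=> linT T0 Teig; rewrite hor_split// T0 mulr0 add0r.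
pose Y := phi (phi X); pose Y_ e := cst ((-1) ^+ e * lambda) *: Y + S Y.
have Yeig e : shape_eigen e (Y_ e).
  split; first by rewrite (gE gP) (gZl gP) g_phi_xi g_shape_xi mulr0 addr0.
  rewrite /Y_ !shapeE shape_shape (phi_phi_hor (g_phi_xi _)) -lambda2.
  case: (e); rewrite ?expr0 ?expr1; field_ring.
apply: cinf_eq => p; rewrite !evalE.
have : T (Y_ false) p - T (Y_ true) p = 0 by rewrite !(Teig _ _ (Yeig _)) subrr.
rewrite /Y_ !(cinf_linearD linT) !(cinf_linearZ linT) !evalE expr0 expr1 => e.
have /eqP : lambda * T Y p = 0 by lra.
by rewrite mulf_eq0 gt_eqF//= => /eqP.
Qed.

(** On eigenfields of S, a component T X Y Z W is zero if X and Y, or Z and W,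
    have opposite eigenvalues. Then so is one with X and Y of one sign and Z of the
    other, by Bianchi. Since phi exchanges the signs and moves from Z to W, the
    components with four equal signs are of that kind too. *)
Lemma curvature_like_eq0 T : curvature_like T ->
  (forall X Y Z, T X Y Z xi = 0) ->
  (forall X Y Z W, g X xi = 0 -> g Y xi = 0 -> g Z xi = 0 -> g W xi = 0 ->
     T X Y (phi Z) W = - T X Y Z (phi W)) ->
  (forall X Y Z W, g X xi = 0 -> g Y xi = 0 -> g Z xi = 0 -> g W xi = 0 ->
     T X Y (S Z) W = T X Y Z (S W)) ->
  forall X Y Z W, T X Y Z W = 0.
Proof.
move=> TP Txi Tphi TS.
have [lin1 s12 s34 b] := TP; have pair := curvature_like_pair TP.
have lin2 := like_linear2 TP.
have lin3 := like_linear3 TP; have lin4 := like_linear4 TP.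
have diff34 e X Y Z W : g X xi = 0 -> g Y xi = 0 ->
    shape_eigen e Z -> shape_eigen (~~ e) W -> T X Y Z W = 0.
  move=> X0 Y0 [Z0 SZ] [W0 SW]; have := TS X Y Z W X0 Y0 Z0 W0.
  rewrite SZ SW (cinf_linearZ (lin3 _ _ _)) (cinf_linearZ (lin4 _ _ _)) => e1.
  apply: cinf_eq => p; have := congr1 (fun f : cinf M => f p) e1.
  rewrite !evalE => e2.
  have /eqP : lambda * T X Y Z W p = 0.
    by move: e2; case: (e); rewrite /= ?expr0 ?expr1; lra.
  by rewrite mulf_eq0 gt_eqF//= => /eqP.
have diff12 e X Y Z W : g Z xi = 0 -> g W xi = 0 ->
    shape_eigen e X -> shape_eigen (~~ e) Y -> T X Y Z W = 0.
  by move=> Z0 W0 Xe Ye; rewrite pair; exact: diff34 Xe Ye.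
have mixed e X Y Z W : shape_eigen e X -> shape_eigen e Y ->
    shape_eigen (~~ e) Z -> g W xi = 0 -> T X Y Z W = 0.
  move=> Xe Ye Ze W0; have := b X Y Z W.
  rewrite (diff12 e Y Z)//; [|by case: Xe].
  by rewrite (s12 X Z) (diff12 e X Z)//; [rewrite oppr0 !addr0|case: Ye].
have eig a c d e X Y Z W : shape_eigen a X -> shape_eigen c Y ->
    shape_eigen d Z -> shape_eigen e W -> T X Y Z W = 0.
  move=> Xe Ye Ze We; have [X0 _] := Xe; have [Y0 _] := Ye.
  have [Z0 _] := Ze; have [W0 _] := We.
  have [ca|ca] := eqVneq c a; last first.
    apply: (diff12 a) => //; suff <- : c = ~~ a by [].
    by case: (c) (a) ca => [] [].
  have [da|da] := eqVneq d a; last first.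
    apply: (mixed a) => //; first by rewrite -ca.
    by suff <- : d = ~~ a by []; case: (d) (a) da => [] [].
  rewrite -(phi_phi_hor W0) -[T _ _ _ _]opprK -Tphi ?g_phi_xi//.
  rewrite (mixed a) ?oppr0 ?g_phi_xi//; first by rewrite -ca.
  by rewrite -da; exact: shape_eigen_phi.
have Txi3 U U' W : T U U' xi W = 0 by rewrite s34 Txi oppr0.
have Txi1 U Z W : T xi U Z W = 0 by rewrite pair Txi3.
have Txi2 U Z W : T U xi Z W = 0 by rewrite pair Txi.
move=> X Y Z W.
apply: (eigen_eq0 (T := fun X => T X Y Z W)) => //.
move=> a {}X Xa; apply: (eigen_eq0 (T := fun Y => T X Y Z W)) => //.
move=> c {}Y Yc; apply: (eigen_eq0 (T := fun Z => T X Y Z W)) => //.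
move=> d {}Z Zd; apply: (eigen_eq0 (T := fun W => T X Y Z W)) => // e {}W We.
exact: eig Xa Yc Zd We.
Qed.

Let gid := form g id.
Let phig := form g phi.
Let Sg := form g S.
Let hg := form g (fun X => phi (S X)).
Let eta2 := form g (fun X => g X xi *: xi).

(** The coefficients are the ones for which the commutators with phi and S and
    the value on xi are those of R. *)
Definition curvature_model X Y Z W : cinf M :=
  cst (- 2^-1 + mu / 4) * kulkarni_nomizu gid gid X Y Z W
  + (cst ((1 - mu / 2) / (-1 - kappa) / 2) * kulkarni_nomizu hg hg X Y Z W
  + (cst ((kappa + mu / 2) / (-1 - kappa) / 2) * kulkarni_nomizu Sg Sg X Y Z W
  + (cst (- mu / 2) * skew_curvature phig X Y Z W
  + (cst (kappa + 1 - mu / 2) * kulkarni_nomizu gid eta2 X Y Z W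
  + (cst (mu - 1) * kulkarni_nomizu hg eta2 X Y Z W
  + kulkarni_nomizu gid hg X Y Z W))))).

Let phigC X Y : g (phi X) Y = - g (phi Y) X.
Proof. by rewrite phi_skew (gC gP). Qed.

Let SgC X Y : g (S X) Y = g (S Y) X.
Proof. by rewrite shape_sym (gC gP). Qed.

Let hgC X Y : g (phi (S X)) Y = g (phi (S Y)) X.
Proof.
by rewrite phi_skew shape_sym shape_phi (gNr gP) opprK (gC gP).
Qed.

Lemma h_linear : endo_linear (fun X => phi (S X)).
Proof. by move=> f X Y; rewrite shape_linear phi_linear. Qed.

Lemma eta_xi_linear : endo_linear (fun X => g X xi *: xi).
Proof. by move=> f X Y; rewrite !(gE gP) scalerDl scalerA. Qed.

Lemma curvature_model_like : curvature_like curvature_model.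
Proof.
have lg Y : cinf_linear (gid^~ Y) by exact: form_linear.
have lphi Y : cinf_linear (phig^~ Y) by exact: form_linear phi_linear.
have lS Y : cinf_linear (Sg^~ Y) by exact: form_linear shape_linear.
have lh Y : cinf_linear (hg^~ Y) by exact: form_linear h_linear.
have leta2 Y : cinf_linear (eta2^~ Y) by exact: form_linear eta_xi_linear.
have eta2C X Y : eta2 X Y = eta2 Y X.
  by rewrite /eta2 /form !(gZl gP) !(gC gP xi) mulrC.
have gC' : forall X Y, gid X Y = gid Y X := gC gP.
do ![apply: curvature_like_lin];
  by [exact: kulkarni_nomizu_like|exact: skew_curvature_like].
Qed.

Lemma curvature_eq_model X Y Z W : g (Rm X Y Z) W = curvature_model X Y Z W.
Proof.
have TP := curvature_like_lin (-1) curvature_model_like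
  (curvature_curvature_like gP nablaP).
have gphi U U' : g U (phi U') = - g (phi U) U' by rewrite phi_skew opprK.
have gS U U' : g U (S U') = g (S U) U' by rewrite shape_sym.
apply/eqP; rewrite -subr_eq0 addrC -mulN1r; apply/eqP; move: X Y Z W.
apply: (curvature_like_eq0 TP) => [X Y Z|X Y Z W X0 Y0 Z0 W0|X Y Z W X0 Y0 Z0 W0].
- rewrite (curvature_skew34 gP nablaP) curvature_xi_nullity.
  rewrite /curvature_model /kulkarni_nomizu /skew_curvature.
  rewrite /hg /Sg /phig /eta2 /gid /form.
  rewrite !(gE gP) !g_phi_xi !g_shape_xi g_xi_xi !(gC gP xi).
  apply: cinf_eq => p; eval_field; exact: lt0r_neq0.
- apply: cinf_eq => p; have := curvature_phi p X0 Y0 Z0 W0.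
  move: (g (Rm X Y (phi Z)) W) (g (Rm X Y Z) (phi W)) => r r' /(canRL (addrK _)).
  rewrite /curvature_model /kulkarni_nomizu /skew_curvature.
  rewrite /hg /Sg /phig /eta2 /gid /form.
  rewrite X0 Y0 !scale0r !(g0l gP) !gphi !phi_phi_shape !phi_phi_hor//.
  generalize_evals => ->; field; exact: lt0r_neq0.
- apply: cinf_eq => p; have := curvature_shape p X0 Y0 Z0 W0.
  move: (g (Rm X Y (S Z)) W) (g (Rm X Y Z) (S W)) => r r' /(canRL (subrK _)).
  rewrite /curvature_model /kulkarni_nomizu /skew_curvature.
  rewrite /hg /Sg /phig /eta2 /gid /form.
  rewrite X0 Y0 !scale0r !(g0l gP) !gS !shape_phi !shape_shape !phiZ.
  rewrite !phi_phi_hor// !(gNl gP) !(gZl gP) !gphi; generalize_evals.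
  move=> ->; field; exact: lt0r_neq0.
Qed.

(** * The Ricci operator *)

(** The traces of h = phi S and of S = phi h vanish because both are products of
    anticommuting endomorphisms. *)
Lemma ricci_curvature (E : 'I_n.*2.+1 -> V) q X W :
  (forall i, g (E i) (E i) q = 1 \/ g (E i) (E i) q = -1) ->
  (forall T Y, cinf_linear T ->
    T Y q = \sum_i g (E i) (E i) q * g Y (E i) q * T (E i) q) ->
  \sum_i g (E i) (E i) q * g (Rm X (E i) (E i)) W q =
  (2 * (1 - n%:R) + n%:R * mu) * g X W q
  + (2 * (n%:R - 1) + mu) * g (phi (S X)) W q
  + (2 * (n%:R - 1) + n%:R * (2 * kappa - mu)) * (g X xi q * g xi W q).
Proof.
move=> Enorm Eexp; pose tr := contraction g E q.
have phialt Y : form g phi Y Y = 0.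
  apply: cinf_eq => p; have := congr1 (fun f : cinf M => f p) (phi_skew Y Y).
  rewrite /form (gC gP Y) !evalE; lra.
have trid : tr (form g id) = 2 * n%:R + 1.
  by rewrite /tr contraction_metric// -addn1 natrD -muln2 natrM mulrC.
have trE U U' : (forall Y, U Y = U' Y) -> tr (form g U) = tr (form g U').
  by move=> UU'; congr (tr (form g _)); apply/funext.
have [plin slin] := (phi_linear, shape_linear).
have [hlin elin] := (h_linear, eta_xi_linear).
have traniti U U' : endo_linear U -> endo_linear U' ->
    (forall Y, U (U' Y) = - U' (U Y)) -> tr (form g (fun Y => U (U' Y))) = 0.
  move=> linU linU' UU'; have := contraction_comm gP Eexp linU linU'.
  rewrite -!/(tr _) /comp; have := trE _ _ UU'.
  rewrite [X in _ = X -> _](contraction_opp _ _ gP) -/(tr _); lra.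
have trh : tr (form g (fun Y => phi (S Y))) = 0.
  by apply: traniti => // Y; rewrite shape_phi opprK.
have trS : tr (form g S) = 0.
  rewrite (_ : S = fun Y => phi (phi (S Y))); last first.
    by apply/funext => Y; rewrite phi_phi_shape.
  apply: (traniti phi (fun Y => phi (S Y))) => // Y.
  by rewrite shape_phi phiN opprK.
have treta : tr (form g (fun Y => g Y xi *: xi)) = 1.
  have := contraction_mul Eexp (g_linear gP xi) xi.
  rewrite g_xi_xi evalE => <-; apply: eq_bigr => i _.
  by rewrite /form (gZl gP) evalM; congr (_ * _); rewrite mulrC.
transitivity (tr (fun Y Z => curvature_model X Y Z W)).
  by apply: eq_bigr => i _; rewrite curvature_eq_model.
rewrite /curvature_model /tr !contraction_lin !contraction_kulkarni_nomizu//.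
rewrite contraction_skew_curvature// -/tr trid trh trS treta /form /=.
rewrite !shape_phi !shape_shape !shapeE shape_xi !phiE !scaler0 !g_phi_xi.
rewrite !phi_phi !(gE gP) ?g_phi_xi ?g_xi_xi.
generalize_evals; field; exact: lt0r_neq0.
Qed.

(** X = eta (X) xi + (Y + phi Y) + (Y - phi Y) with 2 Y = phi^2 X, and Y + phi Y
    and Y - phi Y are eigenvectors of phi. *)
Lemma paracontact_tangent_spanned (q : M) : tangent_spanned n.*2.+1 q.
Proof.
have [[_ _ dims] _ _ _] := pcP; have [[b [_ bP]] [b' [_ b'P]]] := dims q.
suff : tangent_spanned (n + n).+1 q by rewrite addnn.
pose e (i : 'I_(n + n)) :=
  match fintype.split i with inl j => b j | inr j => b' j end.
exists (adjoin (value_at q xi) e) => X.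
have eigen Y (s : R) : s * s = 1 -> phi (phi Y) = Y -> g Y xi = 0 ->
    (kernel_at eta q `&` eigenspace_at phi s q)
      (value_at q (Y + cst s *: phi Y)).
  move=> ss YY Y0; split; exists (Y + cst s *: phi Y); split=> //.
    by rewrite eta_g (gDl gP) (gZl gP) Y0 g_phi_xi mulr0 addr0.
  rewrite phiD phiZ YY; apply/funext => f.
  rewrite -[LHS]/(phi Y f q + s * Y f q) -[RHS]/(s * (Y f q + s * phi Y f q)).
  by rewrite mulrDr mulrA ss mul1r addrC.
pose Y := cst 2^-1 *: phi (phi X).
have Y0 : g Y xi = 0 by rewrite (gZl gP) g_phi_xi mulr0.
have YY : phi (phi Y) = Y by exact: phi_phi_hor.
have : (kernel_at eta q `&` eigenspace_at phi 1 q)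
    (value_at q (Y + cst 1 *: phi Y)).
  by apply: eigen => //; rewrite mulr1.
rewrite bP => -[c cE].
have : (kernel_at eta q `&` eigenspace_at phi (-1) q)
    (value_at q (Y + cst (-1) *: phi Y)).
  by apply: eigen => //; rewrite mulrNN mulr1.
rewrite b'P => -[c' c'E].
exists (adjoin (g X xi q) (fun i : 'I_(n + n) =>
  match fintype.split i with inl j => c j | inr j => c' j end)).
rewrite big_ord_recl big_split_ord /= /adjoin unlift_none /=.
under eq_bigr => j _ do rewrite liftK /= /e (unsplitK (inl j)).
under [X in _ + (_ + X)]eq_bigr => j _ do rewrite liftK /= /e (unsplitK (inr j)).
rewrite -cE -c'E; apply/funext => f.
rewrite -[LHS]/(X f q) -[RHS]/(g X xi q * xi f q +
  ((Y f q + 1 * phi Y f q) + (Y f q + -1 * phi Y f q))).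
rewrite -[Y f q]/(2^-1 * phi (phi X) f q) phi_phi.
rewrite -[(X - _) f q]/(X f q - g X xi q * xi f q); lra.
Qed.

Lemma ricci_operatorE Q X : ricci_operator g nabla Q -> Q X =
  cst (2 * (1 - n%:R) + n%:R * mu) *: X
  + cst (2 * (n%:R - 1) + mu) *: phi (S X)
  + (cst (2 * (n%:R - 1) + n%:R * (2 * kappa - mu)) * g X xi) *: xi.
Proof.
move=> ricQ; set Z := RHS; apply: (g_eq gP) => p W; move: p.
suff e : g (Q X) W - g Z W = 0 by move=> p; rewrite (subr0_eq e).
apply: (generic_vanishing paracontact_tangent_spanned) => q ptw.
have [U [E [[_ Uq] frame ric]]] := ricQ q; have [Enorm Eorth] := frame q Uq.
rewrite -[LHS]/(g (Q X) W q - g Z W q) ric// ricci_curvature//; last first.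
  by move=> T Y; apply: frame_expansion => //; exact: paracontact_tangent_spanned.
by rewrite /Z !(gE gP) !evalE; ring.
Qed.

Lemma exists_horizontal : (0 < n)%N -> exists X, phi (phi X) != 0.
Proof.
move=> n0; have [[_ _ dims] _ _ _] := pcP; have [p _] := manifold_nonempty M.
have [[b [bfree bP]] _] := dims p; pose i0 := Ordinal n0.
apply: contrapT => phi0'.
have : (kernel_at eta p `&` eigenspace_at phi 1 p) (b i0).
  rewrite bP; exists (fun i => (i == i0)%:R).
  rewrite (bigD1 i0) // eqxx scale1r big1 /= ?addr0 // => i /negPf ->.
  by rewrite scale0r.
move=> [[X [Xb X0]] _].
have bi0 : b i0 = 0.
  rewrite -Xb; have /eqP XX : phi (phi X) == 0.
    by apply: contrapT => /negP XX; apply: phi0'; exists X.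
  have := phi_phi X; rewrite XX => /esym/subr0_eq ->.
  apply/funext => f; rewrite -[LHS]/(g X xi p * xi f p) -eta_g X0 mul0r.
  by [].
have := bfree (fun i => (i == i0)%:R).
rewrite (bigD1 i0) // eqxx scale1r bi0 big1 /= ?add0r => [|i /negPf ->].
  by move=> /(_ erefl i0)/eqP; rewrite eqxx oner_eq0.
by rewrite scale0r.
Qed.

Lemma cst_scale_eq0 c X : cst c *: X = 0 -> X != 0 -> c = 0.
Proof.
move=> cX X0; apply: contraTeq isT => c0; case/eqP: X0.
have : cst c^-1 *: (cst c *: X) = 0 by rewrite cX scaler0.
move=> e; apply: vfield_eq_at => f p; have := congr1 (fun Y : V => Y f p) e.
by rewrite !fieldE !evalE mulrA mulVf// mul1r.
Qed.

(** h maps ker eta to itself and anticommutes with phi, whereas I commutes with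
    it. *)
Lemma h_coefficient_eq0 a b c : (0 < n)%N ->
  (forall X, cst a *: phi (S X) = cst b *: X + (cst c * g X xi) *: xi) -> a = 0.
Proof.
move=> n0 aS; have [X X0] := exists_horizontal n0.
have aSphi Y : cst a *: S Y = - (cst b *: phi Y).
  have := aS (phi Y).
  rewrite g_phi_xi mulr0 scale0r addr0 shape_phi phiN phi_phi_shape.
  by rewrite scalerN => /(congr1 (fun Z : V => - Z)); rewrite opprK.
have b0 : b = 0.
  have := congr1 phi (aSphi X); have := aSphi (phi X).
  rewrite shape_phi phiN !phiZ => e1 e2.
  suff : 2 * b = 0 by lra.
  apply: cst_scale_eq0 X0; apply: vfield_eq_at => f p.
  have := congr1 (fun Y : V => Y f p) e1; have := congr1 (fun Y : V => Y f p) e2.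
  rewrite !fieldE; eval_lra.
have aS0 Y : cst a *: S Y = 0.
  rewrite aSphi b0; field_ring.
have := aS0 (S X); rewrite shape_shape => e.
have /eqP : a * (-1 - kappa) = 0.
  apply: cst_scale_eq0 X0; rewrite -e; field_ring.
by rewrite mulf_eq0 (gt_eqF lambda2_gt0) orbF => /eqP.
Qed.

End Paracontact.

Theorem corollary5p12 (R : realType) (n : nat)
    (M : smooth_manifold R n.*2.+1)
    (phi : {linear vfield M -> vfield M}) (xi : vfield M)
    (eta : {linear vfield M -> (cinf M)^o})
    (g : vfield M -> vfield M -> cinf M)
    (nabla : vfield M -> vfield M -> vfield M)
    (Q : vfield M -> vfield M)
    (kappa mu : R) :
  (0 < n)%N ->
  paracontact_metric phi xi eta g ->
  levi_civita g nabla ->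
  kappa_mu_condition phi xi eta nabla kappa mu ->
  kappa < -1 ->
  (exists k : nat, forall p : M,
     index_at g p (eigenspace_at (fun X => phi (h_tensor phi xi X))
                                 (Num.sqrt (-1 - kappa)) p) k) ->
  (exists k : nat, forall p : M,
     index_at g p (eigenspace_at (fun X => phi (h_tensor phi xi X))
                                 (- Num.sqrt (-1 - kappa)) p) k) ->
  ricci_operator g nabla Q ->
  [/\ forall X : vfield M,
        Q X = cinf_cst M (2 * (1 - n%:R) + n%:R * mu) *: X
              + cinf_cst M (2 * (n%:R - 1) + mu) *: h_tensor phi xi X
              + (cinf_cst M (2 * (n%:R - 1) + n%:R * (2 * kappa - mu)) * eta X)
                *: xi,
      eta_einstein xi eta Q <-> mu = 2 * (1 - n%:R)
    & einstein Q <->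
        kappa = (1 - n%:R ^+ 2) / n%:R /\ mu = 2 * (1 - n%:R)].
Proof.
move=> n0 pcP nablaP nullityP kappa_lt _ _ ricQ.
have gP : pseudo_riemannian_metric g by have [] := pcP.
have eta_gE := eta_g pcP; have hE := h_tensorE pcP nablaP.
have n0' : n%:R != 0 :> R by rewrite pnatr_eq0 -lt0n.
set c1 := 2 * (1 - n%:R) + n%:R * mu.
set c2 := 2 * (n%:R - 1) + mu.
set c3 := 2 * (n%:R - 1) + n%:R * (2 * kappa - mu).
have QE X : Q X = cinf_cst M c1 *: X + cinf_cst M c2 *: h_tensor phi xi X
    + (cinf_cst M c3 * eta X) *: xi.
  by rewrite (ricci_operatorE pcP nablaP nullityP kappa_lt X ricQ) hE eta_gE.
have c2_mu : c2 = 0 -> mu = 2 * (1 - n%:R) by rewrite /c2; lra.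
have c2_0 : mu = 2 * (1 - n%:R) -> c2 = 0 by rewrite /c2; lra.
have eta_einstein_c2 a b :
    (forall X, Q X = cinf_cst M a *: X + (cinf_cst M b * eta X) *: xi) -> c2 = 0.
  move=> Qab; apply: (h_coefficient_eq0 pcP nablaP nullityP kappa_lt
    (b := a - c1) (c := b - c3) n0) => X.
  have := Qab X; rewrite QE hE eta_gE => e.
  apply: vfield_eq_at => f p; have := congr1 (fun Y : vfield M => Y f p) e.
  rewrite !fieldE; eval_lra.
split=> //; split.
- by move=> [a [b Qab]]; apply: c2_mu; exact: eta_einstein_c2 Qab.
- move=> /c2_0 c20; exists c1, c3 => X; rewrite QE c20; field_ring.
- move=> [a Qa].
  have c20 : c2 = 0.
    apply: (eta_einstein_c2 a 0) => X; rewrite Qa; field_ring.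
  have [X X0] := exists_horizontal pcP n0.
  have c1a : c1 - a = 0.
    apply: (cst_scale_eq0 _ X0).
    have := Qa (phi (phi X)); rewrite QE c20 (eta_phi pcP) => e.
    apply: vfield_eq_at => f p; have := congr1 (fun Y : vfield M => Y f p) e.
    rewrite !fieldE; eval_lra.
  have c30 : c3 = 0.
    apply: (@cst_scale_eq0 _ _ _ _ xi); last first.
      apply/eqP => xi0; have := eta_xi pcP; rewrite xi0 linear0 => /esym/eqP.
      by rewrite oner_eq0.
    have := Qa xi; rewrite QE c20 (eta_xi pcP) (_ : a = c1); last by lra.
    move=> e; apply: vfield_eq_at => f p.
    have := congr1 (fun Y : vfield M => Y f p) e.
    rewrite !fieldE; eval_lra.
  have mu_n := c2_mu c20; split=> //.
  apply/eqP; rewrite -subr_eq0 -(mulrI_eq0 _ (mulfI n0')); apply/eqP.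
  rewrite mulrBr mulrCA divff// mulr1.
  by move: c30; rewrite /c3 mu_n; lra.
- move=> [kappa_n mu_n]; exists c1 => X; rewrite QE c2_0//.
  have -> : c3 = 0 by rewrite /c3 mu_n kappa_n; field.
  field_ring.
Qed.
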